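(* Let $h_\theta:[0,T]\times\mathbb{R}\times\mathbb{R}\to\mathbb{R}$ satisfy conditions (i)–(v) listed in the context and let $u_0\in H^1(\mathbb{R})\cap L^\infty(\mathbb{R})$. Then the weak solution $u\in L^\infty([0,T];H^1(\mathbb{R})\cap L^\infty(\mathbb{R}))\cap L^2([0,T];H^2(\mathbb{R}))$ to $$\partial_tu=\tfrac12\,\partial_{xx}\left[\left(h_\theta^{-1}(t,x,u)\right)^2u\right],\qquad u(0,\cdot)=u_0(\cdot),$$ is unique.
   Context: Conditions on $h_\theta=h_\theta(t,x,z)$: (i) for each $(t,x)$, $z\mapsto h_\theta(t,x,z)$ is strictly increasing and continuous, with $\lim_{z\to\pm\infty}h_\theta(t,x,z)=\pm\infty$; (ii) $h_\theta$ is globally Lipschitz in all its arguments, and all its partial derivatives up to second order exist and are uniformly bounded; (iii) $\partial_zh_\theta$ is continuous and uniformly bounded below by a constant $c_h>0$; (iv) the solution $h_\theta^{-1}(t,x,0)$ of $h_\theta(t,x,z)=0$ satisfies $0<c_0\le h_\theta^{-1}(t,x,0)\le C_0<\infty$ for all $(t,x)$, with constants $c_0,C_0$; (v) (stability condition) with $M_\infty$ a constant such that $M_\infty\ge\|u_0\|_{L^\infty}$, where $u_0$ is the initial density, one has $c_0^2>\dfrac{2C_0M_\infty}{c_h}$. For $v\in\mathbb{R}$, $h_\theta^{-1}(t,x,v)$ denotes the unique $z$ with $h_\theta(t,x,z)=v$. In the paper $u_0$ is the initial probability density and solutions are densities of probability measures (in particular non-negative). A weak solution is a function $u$ with, for all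 $\phi\in C_c^\infty([0,T)\times\mathbb{R})$, $$-\int_0^T\!\!\int_{\mathbb{R}}u\,\partial_t\phi\,dx\,dt-\int_{\mathbb{R}}u_0\,\phi(0,\cdot)\,dx=\tfrac12\int_0^T\!\!\int_{\mathbb{R}}\left(h_\theta^{-1}(t,x,u)\right)^2u\,\partial_{xx}\phi\,dx\,dt.$$ *)

(* Defs.v *)
From HB Require Import structures.
From mathcomp Require Import all_boot all_order all_algebra.
From mathcomp Require Import all_classical all_reals all_analysis.

Set Implicit Arguments.
Unset Strict Implicit.
Unset Printing Implicit Defensive.

Import Order.TTheory GRing.Theory Num.Theory.
Import numFieldNormedType.Exports.

Local Open Scope ring_scope.
Local Open Scope classical_set_scope.

Section test_functions.
Context {R : realType} {V : normedModType R}.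
Implicit Types (f : V -> R) (O : set V).

(* All iterated directional derivatives of order n exist and are continuous;
   in finite dimension this is the class C^n. *)
Fixpoint is_Cn (n : nat) f : Prop :=
  if n is m.+1 then
    forall v : V, (forall p, derivable f p v) /\ is_Cn m ('D_v f)
  else continuous f.

Definition tsupport f : set V := closure [set p | f p != 0].

Definition test_function O f : Prop :=
  [/\ forall n, is_Cn n f, compact (tsupport f) & tsupport f `<=` O].

End test_functions.

Section sobolev.
Context {R : realType}.
Local Notation mu := (@lebesgue_measure R).
Implicit Types (f g : R -> R) (k j : nat) (p : \bar R).

Definition L2 f : Prop := f \in Lfun mu 2%:E.

Definition Linfty f : Prop := f \in Lfun mu +oo%E.

(* For f and g in L^2 both integrands below are integrable. *)
Definition is_weak_derivative j f g : Prop :=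
  forall phi : R -> R, test_function setT phi ->
    \int[mu]_x (f x * derive1n j phi x) = (-1) ^+ j * \int[mu]_x (g x * phi x).

(* H^k(R) = W^{k,2}(R) *)
Definition sobolevH k f : Prop :=
  L2 f /\ forall j, (j <= k)%N -> exists2 g, L2 g & is_weak_derivative j f g.

(* A representative of the a.e. unique L^2 weak derivative of order j;
   \0 if there is none. *)
Definition weak_derivative j f : R -> R :=
  xget (fun=> 0) [set g | L2 g /\ is_weak_derivative j f g].

Definition Hnorm k f : \bar R :=
  ((\sum_(j < k.+1) 'N[mu]_2%:E [EFin \o weak_derivative j f] `^ 2)%E `^ 2^-1)%E.

Definition H1_Linfty f : Prop := sobolevH 1 f /\ Linfty f.

Definition H1_Linfty_norm f : \bar R :=
  (Hnorm 1 f + 'N[mu]_+oo [EFin \o f])%E.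

(* u \in L^p([0,T]; X) for a normed space (X, N) of functions on the real line.
   Measurability is joint measurability of (t, x) |-> u t x; for the spaces used
   here (H^2, and H^1 with L^oo, which is H^1 up to equivalence of norms, both
   separable) every strongly measurable u has such a representative, and
   conversely by Pettis' theorem. *)
Definition bochner_L p (T : R) (X : set (R -> R)) (N : (R -> R) -> \bar R)
    (u : R -> R -> R) : Prop :=
  [/\ measurable_fun (`[0, T]%classic `*` [set: R])
        (fun q : measurableTypeR R * measurableTypeR R => u q.1 q.2),
      {ae mu, forall t, 0 <= t <= T -> X (u t)} &
      ('N[mu]_p [(fun t => N (u t)) \_ `[0%R, T]] < +oo)%E].

Definition solution_class (T : R) (u : R -> R -> R) : Prop :=
  bochner_L +oo%E T H1_Linfty H1_Linfty_norm u /\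
  bochner_L 2%:E T (sobolevH 2) (Hnorm 2) u.

Definition probability_density f : Prop :=
  [/\ measurable_fun [set: R] f,
      {ae mu, forall x, 0 <= f x} &
      (\int[mu]_x (f x)%:E = 1)%E].

End sobolev.

Section conditions.
Context {R : realType}.
Implicit Types (h : R -> R -> R -> R) (T t x z v : R).

Definition derivable_within (A : set R) (f : R -> R) t : Prop :=
  cvg ((f s - f t) / (s - t) @[s --> within A t^']).

Definition derive_within (A : set R) (f : R -> R) t : R :=
  lim ((f s - f t) / (s - t) @[s --> within A t^']).

Variant coord := Ct | Cx | Cz.

(* h is given on [0,T] x R x R, so the t-derivative is taken relatively to
   [0,T]: it is one-sided at t = 0 and t = T. *)
Definition has_partial T (c : coord) h t x z : Prop :=
  match c with
  | Ct => derivable_within `[0, T] (fun s => h s x z) t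
  | Cx => derivable (fun y => h t y z) x 1
  | Cz => derivable (h t x) z 1
  end.

Definition partial T (c : coord) h t x z : R :=
  match c with
  | Ct => derive_within `[0, T] (fun s => h s x z) t
  | Cx => derive1 (fun y => h t y z) x
  | Cz => derive1 (h t x) z
  end.

(* The unique z such that h t x z = v when h t x is a bijection. *)
Definition h_inv h t x v : R := xget 0 [set z | h t x z = v].

Definition strip T : set (R * R * R) := [set q | 0 <= q.1.1 <= T].

Record h_conditions T h (ch c0 C0 : R) : Prop := HConditions {
  h_increasing : forall t x, 0 <= t <= T ->
    {homo h t x : z w / z < w};
  h_continuous : forall t x, 0 <= t <= T -> continuous (h t x);
  h_limits : forall t x, 0 <= t <= T ->
    h t x z @[z --> +oo] --> +oo /\ h t x z @[z --> -oo] --> -oo;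
  h_lipschitz : [lipschitz h q.1.1 q.1.2 q.2 | q in strip T];
  h_has_partial1 : forall c t x z, 0 <= t <= T -> has_partial T c h t x z;
  h_has_partial2 : forall c d t x z, 0 <= t <= T ->
    has_partial T d (partial T c h) t x z;
  h_partials_bounded : exists K : R, forall t x z, 0 <= t <= T ->
    (forall c, `|partial T c h t x z| <= K) /\
    (forall c d, `|partial T d (partial T c h) t x z| <= K);
  h_dz_continuous : {within strip T, continuous
    (fun q : R * R * R => partial T Cz h q.1.1 q.1.2 q.2)};
  h_ch_gt0 : 0 < ch;
  h_dz_lower_bound : forall t x z, 0 <= t <= T ->
    ch <= partial T Cz h t x z;
  h_c0_gt0 : 0 < c0;
  h_inv0_bounds : forall t x, 0 <= t <= T ->
    c0 <= h_inv h t x 0 <= C0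
}.

End conditions.

Section weak_solution.
Context {R : realType}.
Local Notation mu := (@lebesgue_measure R).
Implicit Types (h : R -> R -> R -> R) (u : R -> R -> R) (T : R).

(* C_c^oo([0,T[ x R) is obtained by restricting to t >= 0 the smooth functions
   with compact support in ]-oo,T[ x R; they need not vanish at t = 0. *)
Definition weak_solution T h (u0 : R -> R) u : Prop :=
  forall phi : R * R -> R, test_function (`]-oo, T[%classic `*` setT) phi ->
  - (\int[mu]_(t in `[0, T]) \int[mu]_x (u t x * 'D_(1, 0) phi (t, x)))
    - \int[mu]_x (u0 x * phi (0, x))
  = 2^-1 * \int[mu]_(t in `[0, T]) \int[mu]_x
      (h_inv h t x (u t x) ^+ 2 * u t x * 'D_(0, 1) ('D_(0, 1) phi) (t, x)).

End weak_solution.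

(* Main.v *)
From HB Require Import structures.
Require Import Defs.
From mathcomp Require Import all_boot all_order all_algebra.
From mathcomp Require Import all_classical all_reals all_analysis.
From mathcomp Require Import measurable_realfun ess_sup_inf.
From mathcomp Require Import ring lra.

Import Order.TTheory GRing.Theory Num.Theory.
Import numFieldNormedType.Exports.

Local Open Scope ring_scope.
Local Open Scope classical_set_scope.

(** Let u and v be two solutions with the same initial density. With
    w = u - v and g = flux u - flux v, where the flux of f is
    h_inv(t, x, f)^2 f, the difference of the two weak formulations says that
    w_t = g_xx / 2 weakly, with w = 0 at time 0. The flux is strongly
    monotone: h_inv is nondecreasing in its last argument and at least c0 at
    nonnegative densities, so that g w >= c0^2 w^2 (flux_monotone). It
    therefore suffices to prove that the integral of g w over [0, T] x R is at
    most 0; monotone_flux_unique then gives w = 0 almost everywhere.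

    Formally this is an energy estimate: integrated in time, the equation reads
    w = B_xx / 2 with B(t, x) the integral of g(s, x) over s < t, and
    g = B_t, hence the integral of g w is -1/4 times the space integral of
    (B_x)^2 at time T. Neither derivative of B is available, so the
    computation is made on mollifications. Test functions theta(t) psi(x) and
    du Bois-Reymond's lemma in t (du_bois_reymond) give, for almost every t,

      int w(t, x) psi(x) dx = 1/2 int_{s < t} int g(s, x) psi''(x) dx ds.

    For psi one takes x |-> K(x, x'), where K(x, x') is the integral over y of
    k(x + y) k(x' + y) for a bump k of radius r. Two integrations by parts turn
    the second derivative of K into minus the autocorrelation of k'. Pairing
    with g(t, x') over all (t, x') leaves a negative multiple of the double
    integral of g(s, x) g(t, x') over s < t against this autocorrelation.
    Exchanging the two points shows that this is half of the integral without
    the restriction on s and t, which is nonnegative because an autocorrelation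
    is a positive definite kernel (corr_positive_definite). So the integral of g
    against w mollified by K is at most 0 (energy_le0).

    It remains to let r tend to 0. Replacing the mollified w by w times the
    mass of K costs at most a constant times the mean oscillation of w at
    scale r, which tends to 0 at Lebesgue points and, by dominated convergence,
    in the mean with weight |g| (weighted_oscillation_cvg0). The bumps have a
    lower bound that does not depend on r, which keeps the mass of K
    comparable to r^2 and yields pairing_le0.

    Solutions are known only up to null sets, so the argument is run on
    representatives defined everywhere, with values in an interval [0, M] and
    vanishing outside the strip (clipped_representative). *)

(** * Smooth functions *)

Section smooth_functions.
Context {R : realType} {V : normedModType R}.
Implicit Types (f g : V -> R) (v p : V).

Definition smooth f : Prop := forall n, is_Cn n f.

Lemma smooth_continuous f : smooth f -> continuous f.
Proof. exact: (fun sf => sf 0%N). Qed.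

Lemma smooth_derivable f p v : smooth f -> derivable f p v.
Proof. by move=> /(_ 1%N v)[]. Qed.

Lemma smooth_derive f v : smooth f -> smooth ('D_v f).
Proof. by move=> sf n; have [] := sf n.+1 v. Qed.

Lemma is_CnD n f g : is_Cn n f -> is_Cn n g -> is_Cn n (f \+ g).
Proof.
elim: n f g => [|n IHn] f g /=.
  by move=> cf cg x; apply: cvgD; [exact: cf|exact: cg].
move=> cf cg v; have [df Df] := cf v; have [dg Dg] := cg v.
split=> [p|]; first exact: derivableD.
rewrite (_ : 'D_v _ = 'D_v f \+ 'D_v g); first exact: IHn.
by apply/funext => p; rewrite deriveD.
Qed.

Lemma is_CnZ n f (c : R) : is_Cn n f -> is_Cn n (fun p => c * f p).
Proof.
elim: n f => [|n IHn] f /=.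
  by move=> cf x; apply: cvgM; [exact: cvg_cst|exact: cf].
move=> cf v; have [df Df] := cf v.
split=> [p|]; first exact: derivableZ.
rewrite (_ : 'D_v _ = fun p => c * 'D_v f p); first exact: IHn.
by apply/funext => p; rewrite [LHS]deriveZ.
Qed.

(** The induction runs over smooth factors: in a general normed space the
    existence and continuity of directional derivatives of order n.+1 do not
    give continuity at order n, which the Leibniz rule calls for. *)
Lemma smoothM f g : smooth f -> smooth g -> smooth (f \* g).
Proof.
move=> sf sg n; elim: n f g sf sg => [|n IHn] f g sf sg.
  by move=> x; apply: cvgM; exact: smooth_continuous.
move=> v; split=> [p|]; first by apply: derivableM; exact: smooth_derivable.
rewrite (_ : 'D_v _ = (f \* 'D_v g) \+ (g \* 'D_v f)).
  by apply: is_CnD; apply: IHn => //; exact: smooth_derive.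
by apply/funext => p; rewrite [LHS]deriveM//; exact: smooth_derivable.
Qed.

End smooth_functions.

(** L is affine with linear part l; translations, dilations and coordinate
    projections are the instances below. *)
Section affine_composition.
Context {R : realType} {V W : normedModType R}.
Variables (L : V -> W) (l : V -> W).
Hypothesis L_continuous : continuous L.
Hypothesis L_affine : forall (c : R) v p, L (c *: v + p) = c *: l v + L p.

Lemma derivable_comp_affine (f : W -> R) v p :
  derivable f (L p) (l v) -> derivable (f \o L) p v.
Proof.
rewrite /derivable (_ : (fun c : R => c^-1 *: ((f \o L) (c *: v + p) - _)) =
  (fun c : R => c^-1 *: (f (c *: l v + L p) - f (L p)))) //.
by apply/funext => c /=; rewrite L_affine.
Qed.

Lemma derive_comp_affine (f : W -> R) v p :
  'D_v (f \o L) p = 'D_(l v) f (L p).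
Proof.
rewrite /derive (_ : (fun c : R => c^-1 *: ((f \o L) (c *: v + p) - _)) =
  (fun c : R => c^-1 *: (f (c *: l v + L p) - f (L p)))) //.
by apply/funext => c /=; rewrite L_affine.
Qed.

Lemma smooth_comp_affine (f : W -> R) : smooth f -> smooth (f \o L).
Proof.
move=> sf n; elim: n f sf => [|n IHn] f sf.
  by move=> x; apply: continuous_comp; [exact: L_continuous|exact: (sf 0%N)].
move=> v; split=> [p|].
  by apply: derivable_comp_affine; exact: smooth_derivable.
rewrite (_ : 'D_v _ = ('D_(l v) f) \o L); first exact/IHn/smooth_derive.
by apply/funext => p; rewrite derive_comp_affine.
Qed.

End affine_composition.

Section smooth_on_the_line.
Context {R : realType}.
Implicit Types (f : R -> R).

Lemma derivable1_dir f (x v : R) :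
  derivable f x 1 -> derivable f x v.
Proof. by move=> /derivable1_diffP/diff_derivable. Qed.

Lemma derive1_dir f (x v : R) :
  derivable f x 1 -> 'D_v f x = v * 'D_1 f x.
Proof.
move=> /derivable1_diffP df; rewrite !deriveE//.
by rewrite -[X in 'd f x X]mulr1 -[v * 1]/(v *: 1) linearZ.
Qed.

(** On the line all directional derivatives are multiples of one of them. *)
Lemma is_CnS_line n f : (forall x, derivable f x 1) -> is_Cn n ('D_1 f) ->
  is_Cn n.+1 f.
Proof.
move=> df cDf v; split=> [p|]; first exact: derivable1_dir.
rewrite (_ : 'D_v f = fun x => v * 'D_1 f x); first exact: is_CnZ.
by apply/funext => x; exact: derive1_dir.
Qed.

End smooth_on_the_line.

Section bump.
Context {R : realType}.

(** The building blocks of the smooth function that vanishes for x <= 0 and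
    equals exp(-1/x) for x > 0: the linear span of this family is closed under
    differentiation. *)
Definition flat n (x : R) : R := if 0 < x then x ^- n * expR (- x^-1) else 0.

(** From exp y >= y^m / m! at y = 1/x; the square on the right makes the
    derivative at 0 vanish. *)
Lemma flat_bound n x : `|flat n x| <= (n.+2)`!%:R * x ^+ 2.
Proof.
rewrite /flat; case: ifPn => [x0|_]; last first.
  by rewrite normr0 mulr_ge0// sqr_ge0.
have y0 : 0 < x^-1 by rewrite invr_gt0.
have H : x^-1 ^+ n.+2 / n.+2`!%:R <= expR x^-1.
  by rewrite (le_trans _ (expR_ge1Dxn n.+1 (ltW y0)))// lerDr.
have f0 : (0 : R) < n.+2`!%:R by rewrite ltr0n fact_gt0.
have xn0 : 0 < x ^+ n.+2 by rewrite exprn_gt0.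
have e0 := expR_gt0 x^-1.
rewrite ger0_norm; last first.
  by apply: mulr_ge0; [rewrite invr_ge0; apply: exprn_ge0; exact: ltW|exact: expR_ge0].
have xn0' : 0 < x ^+ n by rewrite exprn_gt0.
rewrite expRN -invfM -[leLHS]mul1r ler_pdivrMr; last exact: mulr_gt0.
move: H; rewrite exprVn -invfM -[leLHS]mul1r ler_pdivrMr; last exact: mulr_gt0.
move=> H.
by rewrite (le_trans H)// le_eqVlt; apply/orP; left; apply/eqP; rewrite !exprS; ring.
Qed.

Lemma flat_le0 n x : x <= 0 -> flat n x = 0.
Proof. by move=> x0; rewrite /flat ltNge x0. Qed.

Lemma is_derive_flat n (x : R) :
  is_derive x 1 (flat n) (- n%:R * flat n.+1 x + flat n.+2 x).
Proof.
have [x0|x0|->] := ltgtP x 0.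
- rewrite !flat_le0 ?ltW// mulr0 addr0.
  apply: (@near_eq_is_derive _ R R (cst 0)).
  near=> y; rewrite flat_le0//; near: y; exact: lt_le_nbhsl.
- have dV : is_derive x 1 (fun y : R => y^-1) (- x ^- 2).
    have := @is_deriveV R id x 1 1 (lt0r_neq0 x0) (is_derive_id _ _).
    by rewrite /= [_ *: _]mulr1.
  have dE : is_derive x 1 (expR \o (fun y => - y^-1)) (expR (- x^-1) * x ^- 2).
    rewrite -[x ^- 2]opprK; apply: is_derive1_comp; exact: is_deriveN.
  pose F : R -> R := (fun y => y^-1) ^+ n * (expR \o (fun y => - y^-1)).
  have dF : is_derive x 1 F (- n%:R * flat n.+1 x + flat n.+2 x).
    have D := is_deriveM (is_deriveX n dV) dE.
    apply: (@is_derive_eq _ _ _ _ _ _ _ _ D).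
    rewrite /flat x0 /= !fctE /= /GRing.scale/= {F D}.
    case: n => [|n].
      by rewrite !expr0 !mul0r oppr0 !mul0r mulr0 addr0 add0r; field; lra.
    by rewrite /= !exprVn !exprS; field; rewrite expf_neq0; lra.
  apply: (@near_eq_is_derive _ R R F).
  near=> y; have y0 : 0 < y by near: y; exact: lt_nbhsr.
  by rewrite /F /flat y0 /= -exprVn !fctE.
- rewrite !flat_le0// mulr0 addr0.
  have lim0 : h^-1 *: (flat n (h *: 1 + 0) - flat n 0) @[h --> 0^'] --> (0 : R).
    apply/cvgr0Pnorm_lt => e e0.
    pose C : R := n.+2`!%:R.
    have C0 : 0 < C by rewrite ltr0n fact_gt0.
    near=> h.
    have h0 : h != 0 by near: h; exact: nbhs_dnbhs_neq.
    rewrite [flat n 0]flat_le0// subr0 addr0 [h *: 1]mulr1 normrM normfV.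
    rewrite ltr_pdivrMl ?normr_gt0//.
    rewrite (le_lt_trans (flat_bound _ _))// -/C -real_normK ?num_real// expr2.
    rewrite mulrCA ltr_pM2l ?normr_gt0//.
    rewrite -ltr_pdivlMl// mulrC.
    near: h; apply: (@dnbhs0_lt _ R); by rewrite divr_gt0.
  apply: DeriveDef; first by apply/cvg_ex; exists 0.
  by apply/cvg_lim.
Unshelve. all: by end_near. Qed.

Lemma smooth_flat : smooth (flat 0).
Proof.
move=> m; move: 0%N => k; elim: m k => [|m IHm] k.
  move=> x; apply: differentiable_continuous; apply/derivable1_diffP.
  by have [] := is_derive_flat k x.
apply: is_CnS_line => [x|]; first by have [] := is_derive_flat k x.
rewrite (_ : 'D_(1 : R) _ = (fun x : R => - k%:R * flat k.+1 x) \+ flat k.+2).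
  by apply: is_CnD => //; exact: is_CnZ.
by apply/funext => x; have [_] := is_derive_flat k x.
Qed.

Lemma flat_ge0 x : 0 <= flat 0 x.
Proof. by rewrite /flat; case: ifPn => // _; rewrite mulr_ge0// ?expR_ge0// invr_ge0. Qed.

Lemma flat_le1 x : flat 0 x <= 1.
Proof.
rewrite /flat; case: ifPn => // x0; rewrite expr0 invr1 mul1r -expR0 ler_expR.
by rewrite oppr_le0 invr_ge0 ltW.
Qed.

Lemma flat_ge x : 1 / 2 <= x -> expR (- 2) <= flat 0 x.
Proof.
move=> x2; have x0 : 0 < x by lra.
rewrite /flat x0 expr0 invr1 mul1r ler_expR lerN2.
by rewrite -[X in _ <= X]invrK lef_pV2 ?posrE//; lra.
Qed.

Lemma continuous_affine (a b : R) : continuous (fun x : R => a * x + b).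
Proof.
move=> x; apply: cvgD; last exact: cvg_cst.
by apply: cvgM; [exact: cvg_cst|exact: cvg_id].
Qed.

(** The bump is flat(1 + x/r) flat(1 - x/r). Its lower bound c near the origin
    is the same for all radii, which is what allows r to tend to 0 later. *)
Lemma bump_exists : exists2 c : R, 0 < c & forall r : R, 0 < r ->
  exists k : R -> R, [/\ smooth k,
    forall x, 0 <= k x <= 1,
    forall x, r <= `|x| -> k x = 0 &
    forall x, `|x| <= r / 2 -> c <= k x].
Proof.
exists (expR (- 2) * expR (- 2)) => [|r r0]; first by rewrite mulr_gt0 ?expR_gt0.
pose A (s : R) (x : R) : R := s / r * x + 1.
have sA s : smooth (flat 0 \o A s).
  apply: (@smooth_comp_affine _ _ _ _ (fun v => s / r * v)).
  - exact: continuous_affine.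
  - by move=> c v p; rewrite /A /GRing.scale/=; ring.
  - exact: smooth_flat.
exists ((flat 0 \o A 1) \* (flat 0 \o A (-1))); split.
- exact: smoothM.
- by move=> x /=; rewrite mulr_ge0 ?flat_ge0//= mulr_ile1 ?flat_ge0 ?flat_le1.
- move=> x rx /=; have [x0|x0] := leP 0 x.
    rewrite ger0_norm// in rx.
    rewrite [X in _ * X]flat_le0 ?mulr0// /A mulN1r mulNr addrC subr_le0.
    by rewrite ler_pdivlMl// mulr1.
  rewrite ltr0_norm// in rx.
  rewrite flat_le0 ?mul0r// /A mul1r -lerBrDr sub0r mulrC ler_pdivrMr// mulN1r.
  by rewrite lerNr.
- move=> x xr /=; move: xr; rewrite ler_norml => /andP[x1 x2].
  have y1 : x / r <= 1 / 2 by rewrite ler_pdivrMr// mulrC mulrA mulr1.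
  have y2 : - (1 / 2) <= x / r.
    by rewrite ler_pdivlMr// mulNr mulrC mulrA mulr1.
  by rewrite ler_pM ?expR_ge0// flat_ge// /A ?mul1r ?mulN1r 1?mulrC ?mulrN; lra.
Qed.

End bump.

(** * Compact supports and tensor products *)

Section compact_support.
Context {R : realType}.
Local Notation mu := (@lebesgue_measure R).
Implicit Types (f g : R -> R) (a b : R).

Definition supp_in a b f : Prop := forall x, ~~ (a <= x <= b) -> f x = 0.

Lemma tsupport_supp_in {V : normedModType R} (f : V -> R) (K : set V) :
  closed K -> (forall x, ~ K x -> f x = 0) -> tsupport f `<=` K.
Proof.
move=> cK fK; rewrite /tsupport [X in _ `<=` X](closure_id K).1//.
apply: closure_subset => x /= fx; apply: contrapT => Kx.
by move: fx; rewrite fK// eqxx.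
Qed.

(** Enclosing the support in a compact set K replaces the computation of
    closures. *)
Lemma test_function_supp_in {V : normedModType R} (f : V -> R) (K O : set V) :
  smooth f -> closed K -> compact K -> K `<=` O -> 
  (forall x, ~ K x -> f x = 0) -> test_function O f.
Proof.
move=> sf cK kK KO fK; have sK := tsupport_supp_in _ _ cK fK.
split=> //; last exact: subset_trans KO.
by apply: subclosed_compact sK => //; exact: closed_closure.
Qed.

Lemma supp_in_derive a b f : supp_in a b f -> supp_in a b ('D_1 f).
Proof.
move=> fab x xab.
have nab : \forall y \near x, ~~ (a <= y <= b).
  move: xab; rewrite negb_and -!ltNge => /orP[xa|bx].
    near=> y; rewrite negb_and -!ltNge; apply/orP; left.
    by near: y; exact: lt_nbhsl.
  near=> y; rewrite negb_and -!ltNge; apply/orP; right.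
  by near: y; exact: lt_nbhsr.
rewrite (@near_eq_derive _ _ _ _ (cst 0)) ?derive_cst//.
by near=> y; rewrite fab//; near: y.
Unshelve. all: by end_near. Qed.

Lemma continuous_supp_in_bounded a b f : continuous f -> supp_in a b f ->
  exists2 C, 0 <= C & forall x, `|f x| <= C.
Proof.
move=> cf fab.
have [ab|ba] := leP a b; last first.
  exists 0 => // x; rewrite fab ?normr0//.
  by apply/negP => /andP[ax xb]; lra.
have cn : {within `[a, b], continuous (fun x => `|f x|)}.
  by apply: continuous_subspaceT => x; apply: cvg_norm; exact: cf.
have [c _ fc] := EVT_max ab cn.
exists `|f c| => // x; have [xab|/fab->] := boolP (a <= x <= b).
  by apply: fc; rewrite in_itv.
by rewrite normr0.
Qed.

Lemma Rintegral_supp_in a b f : supp_in a b f ->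
  \int[mu]_x f x = \int[mu]_(x in `[a, b]) f x.
Proof.
move=> fab; rewrite [RHS]Rintegral_mkcond; apply: eq_Rintegral => x _.
by rewrite patchE; case: ifPn => //; rewrite notin_setE/= in_itv/= => /negP/fab.
Qed.

Lemma integrable_supp_in a b f : continuous f -> supp_in a b f ->
  mu.-integrable [set: R] (EFin \o f).
Proof.
move=> cf fab.
rewrite (_ : EFin \o f = (EFin \o f) \_ `[a, b]); last first.
  apply/funext => x; rewrite patchE; case: ifPn => //=.
  by rewrite notin_setE/= in_itv/= => /negP/fab->.
apply/(integrable_mkcond _ _).1 => //.
by apply: continuous_compact_integrable; [exact: segment_compact|exact: continuous_subspaceT].
Qed.

Lemma continuous_within_itv a b f :
  continuous f -> {within `[a, b], continuous f}.
Proof. by move=> cf; apply: (continuous_subspaceT cf). Qed.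

(** The fundamental theorem of calculus on an interval whose ends lie strictly
    outside the support, where f vanishes. *)
Lemma Rintegral_derive_supp_in a b f : smooth f -> supp_in a b f ->
  \int[mu]_x 'D_1 f x = 0.
Proof.
move=> sf fab.
have [c [ca cb]] : exists c, c < a /\ c < b.
  by case: (leP a b) => ab; [exists (a - 1)|exists (b - 1)]; split; lra.
have [d [ad bd]] : exists d, a < d /\ b < d.
  by case: (leP a b) => ab; [exists (b + 1)|exists (a + 1)]; split; lra.
have cd : c < d by lra.
have fcd : supp_in c d f.
  move=> x xcd; apply: fab; apply: contra xcd => /andP[ax xb].
  by apply/andP; split; lra.
rewrite (Rintegral_supp_in c d); last exact: supp_in_derive.
pose g : R -> R := fun x => 'D_1 f x.
have cg : continuous g by exact/smooth_continuous/smooth_derive.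
have fg x : derive1 f x = g x by rewrite derive1E.
rewrite /Rintegral (@continuous_FTC2 _ _ f)//.
- by rewrite !fab ?subee// negb_and -!ltNge ?ca ?bd ?orbT.
- by apply: continuous_within_itv; exact: cg.
- split.
  + by move=> x _; exact: smooth_derivable.
  + by apply: cvg_at_right_filter; exact: smooth_continuous.
  + by apply: cvg_at_left_filter; exact: smooth_continuous.
Qed.

(** A primitive of a test function is again one as soon as the integral
    vanishes. *)
Lemma supp_in_primitive a b f : smooth f -> supp_in a b f ->
    \int[mu]_x f x = 0 ->
  let F x := \int[mu]_(s in `]-oo, x]) f s in
  [/\ smooth F, supp_in a b F & 'D_1 F = f].
Proof.
move=> sf fab f0 F.
have intf : mu.-integrable [set: R] (EFin \o f).
  by apply: integrable_supp_in fab; exact: smooth_continuous.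
have dF x : derivable F x 1 /\ F^`() x = f x.
  apply: (@continuous_FTC1 _ _ _ _ (x + 1)) => //.
  - by rewrite ltrDl.
  - by apply: integrableS intf.
  - by rewrite ltNyr.
  - exact: (smooth_continuous _ sf x).
have DF : 'D_1 F = f by apply/funext => x; rewrite -derive1E; have [] := dF x.
split=> //.
- move=> [|n].
    move=> x; apply: differentiable_continuous; apply/derivable1_diffP.
    by have [] := dF x.
  apply: is_CnS_line => [x|]; first by have [] := dF x.
  by rewrite DF; exact: sf.
- move=> x; rewrite negb_and -!ltNge => /orP[xa|bx].
    rewrite /F (@eq_Rintegral _ _ _ mu _ (cst 0)) ?Rintegral_cst ?mul0r//.
    move=> y; rewrite inE/= in_itv/= => yx; rewrite fab//.
    by rewrite negb_and -!ltNge (le_lt_trans yx).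
  rewrite -f0 /F Rintegral_mkcond; apply: eq_Rintegral => y _.
  rewrite patchE; case: ifPn => //; rewrite notin_setE/= in_itv/= => /negP.
  rewrite -ltNge => xy; rewrite fab//.
  by rewrite negb_and -!ltNge (lt_trans bx xy) orbT.
Qed.

End compact_support.

Section tensor.
Context {R : realType}.
Implicit Types (f g : R -> R).

Definition tensor f g (p : R * R) : R := f p.1 * g p.2.

Lemma smooth_fst f : smooth f -> smooth (f \o (fst : R * R -> R)).
Proof.
apply: (@smooth_comp_affine _ _ _ _ fst) => // p; exact: cvg_fst.
Qed.

Lemma smooth_snd f : smooth f -> smooth (f \o (snd : R * R -> R)).
Proof.
apply: (@smooth_comp_affine _ _ _ _ snd) => // p; exact: cvg_snd.
Qed.

Lemma smooth_tensor f g : smooth f -> smooth g -> smooth (tensor f g).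
Proof.
by move=> sf sg; apply: smoothM; [exact: smooth_fst|exact: smooth_snd].
Qed.

Lemma derive_tensor f g (v p : R * R) : smooth f -> smooth g ->
  'D_v (tensor f g) p =
  v.1 * ('D_1 f p.1 * g p.2) + v.2 * (f p.1 * 'D_1 g p.2).
Proof.
move=> sf sg; rewrite /tensor.
rewrite (_ : (fun p => _) = (f \o (fst : R * R -> R)) * (g \o (snd : R * R -> R)))//.
rewrite deriveM; last 2 first.
- exact/smooth_derivable/smooth_fst.
- exact/smooth_derivable/smooth_snd.
rewrite (@derive_comp_affine _ _ _ (fst : R * R -> R) fst)//.
rewrite (@derive_comp_affine _ _ _ (snd : R * R -> R) snd)//.
rewrite !(derive1_dir _ _ v.1, derive1_dir _ _ v.2); try exact: smooth_derivable.
by rewrite /GRing.scale/=; ring.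
Qed.

Lemma derive_tensor_fst f g t x : smooth f -> smooth g ->
  'D_((1 : R), (0 : R)) (tensor f g) (t, x) = 'D_1 f t * g x.
Proof. by move=> sf sg; rewrite derive_tensor//= mul1r mul0r addr0. Qed.

Lemma derive_tensor_snd2 f g t x : smooth f -> smooth g ->
  'D_((0 : R), (1 : R)) ('D_((0 : R), (1 : R)) (tensor f g)) (t, x) =
  f t * 'D_1 ('D_1 g) x.
Proof.
move=> sf sg; rewrite (_ : 'D_(_, _) (tensor f g) = tensor f ('D_1 g)).
  by rewrite derive_tensor//=; [rewrite mul1r mul0r add0r|exact: smooth_derive].
by apply/funext => -[s y]; rewrite derive_tensor//= mul1r mul0r add0r.
Qed.

Lemma test_function_tensor f g T (a b c d : R) : smooth f -> smooth g ->
  supp_in a b f -> supp_in c d g -> b < T ->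
  test_function (`]-oo, T[%classic `*` setT) (tensor f g).
Proof.
move=> sf sg fab gcd bT.
apply: (@test_function_supp_in _ _ _ (`[a, b]%classic `*` `[c, d]%classic)).
- exact: smooth_tensor.
- apply: compact_closed; first exact: norm_hausdorff.
  by apply: compact_setX; exact: segment_compact.
- by apply: compact_setX; exact: segment_compact.
- by move=> [t x] /= [tab _]; split=> //; move: tab; rewrite !in_itv/= => /andP[_ /le_lt_trans]; exact.
- move=> [t x] /= /not_andP[tab|xcd]; rewrite /tensor/=.
    by rewrite fab ?mul0r//; apply/negP; rewrite in_itv/= in tab.
  by rewrite gcd ?mulr0//; apply/negP; rewrite in_itv/= in xcd.
Qed.

End tensor.

(** * Iterated integrals of real-valued functions *)

Section real_fubini.
Context {d1 d2} {T1 : measurableType d1} {T2 : measurableType d2} {R : realType}.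
Variables (m1 : {sigma_finite_measure set T1 -> \bar R})
  (m2 : {sigma_finite_measure set T2 -> \bar R}).
Implicit Types F : T1 * T2 -> R.

(** The integral is the finite part of a difference of two integrals of
    nonnegative functions, both measurable in x by Tonelli's theorem. *)
Lemma measurable_Rintegral F : measurable_fun [set: T1 * T2] F ->
  measurable_fun [set: T1] (fun x => \int[m2]_y F (x, y)).
Proof.
move=> mF.
have mEF : measurable_fun setT (EFin \o F) by exact/measurable_EFinP.
have mP := measurable_fun_fubini_tonelli_F (m2 := m2) _
  (measurable_funepos mEF) (funepos_ge0 _).
have mN := measurable_fun_fubini_tonelli_F (m2 := m2) _
  (measurable_funeneg mEF) (funeneg_ge0 _).
have := measurableT_comp (fine_measurable measurableT) (emeasurable_funB mP mN).
apply: eq_measurable_fun => x _ /=.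
rewrite [in RHS]/Rintegral [in RHS]integralE /fubini_F.
congr (fine (_ - _)); apply: eq_integral => y _.
  by rewrite !funeposE.
by rewrite !funenegE.
Qed.

(** Tonelli's theorem with an integrable bound G for the integrals of the
    slices. *)
Lemma integrable_prod F (G : T1 -> R) : measurable_fun [set: T1 * T2] F ->
  m1.-integrable [set: T1] (EFin \o G) ->
  (forall x, (\int[m2]_y `|F (x, y)|%:E <= (G x)%:E)%E) ->
  (m1 \x m2)%E.-integrable [set: T1 * T2] (EFin \o F).
Proof.
move=> mF iG FG.
have mEF : measurable_fun setT (EFin \o F) by exact/measurable_EFinP.
apply/integrable12ltyP => //=.
have /integrableP[mG] := iG; apply: le_lt_trans; apply: ge0_le_integral => //.
- by move=> x _; exact: integral_ge0.
- apply: (@measurable_fun_fubini_tonelli_F _ _ _ _ _ _ (fun z => `|F z|%:E)%E) => //=.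
  by apply/measurable_EFinP; exact: measurableT_comp.
- by apply: measurableT_comp.
- by move=> x _; rewrite (le_trans (FG x))//= lee_fin ler_norm.
Qed.

Section integrable.
Variable F : T1 * T2 -> R.
Hypothesis iF : (m1 \x m2)%E.-integrable [set: T1 * T2] (EFin \o F).

Let ae1 : {ae m1, forall x, (\int[m2]_y (F (x, y))%:E)%E =
  (\int[m2]_y F (x, y))%:E}.
Proof.
apply: filterS (ae_integrable1 iF) => x ix.
by rewrite /Rintegral fineK//; exact: integrable_fin_num.
Qed.

Let mF : measurable_fun [set: T1 * T2] F.
Proof. by apply/measurable_EFinP; exact: measurable_int iF. Qed.

Lemma integrable_Rintegral :
  m1.-integrable [set: T1] (EFin \o (fun x => \int[m2]_y F (x, y))).
Proof.
have /integrableP[mI] := integrable_fubini_F iF.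
have mR : measurable_fun setT (EFin \o (fun x => \int[m2]_y F (x, y))).
  by apply/measurable_EFinP; exact: measurable_Rintegral.
move=> lty; apply/integrableP; split=> //; apply: le_lt_trans lty.
rewrite le_eqVlt; apply/orP; left; apply/eqP.
apply: ae_eq_integral => //; try exact: measurableT_comp.
by apply: filterS ae1 => x /= + _; rewrite /fubini_F/= => ->.
Qed.

Lemma Rintegral_prod1 :
  \int[m1]_x \int[m2]_y F (x, y) = \int[(m1 \x m2)%E]_z F z.
Proof.
rewrite /Rintegral -[in RHS]integral12_prod_meas1//; congr fine.
apply: ae_eq_integral => //.
- by apply/measurable_EFinP; exact: measurable_Rintegral.
- exact: (measurable_fubini_F iF).
- by apply: filterS ae1 => x + _ => /esym.
Qed.

End integrable.

End real_fubini.

Section real_fubini_swap.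
Context {d1 d2} {T1 : measurableType d1} {T2 : measurableType d2} {R : realType}.
Variables (m1 : {sigma_finite_measure set T1 -> \bar R})
  (m2 : {sigma_finite_measure set T2 -> \bar R}).

Lemma RFubini (F : T1 * T2 -> R) :
  (m1 \x m2)%E.-integrable [set: T1 * T2] (EFin \o F) ->
  \int[m1]_x \int[m2]_y F (x, y) = \int[m2]_y \int[m1]_x F (x, y).
Proof.
move=> iF; rewrite (Rintegral_prod1 _ _ _ iF) /Rintegral.
rewrite -(integral21_prod_meas1 iF); congr fine.
have mF : measurable_fun setT F.
  by apply/measurable_EFinP; exact: measurable_int iF.
apply: ae_eq_integral => //.
- exact: (measurable_fubini_G iF).
- apply/measurable_EFinP; apply: (measurable_Rintegral m1 (fun z => F (z.2, z.1))).
  by apply: measurableT_comp => //; apply: measurable_fun_pair.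
- apply: filterS (ae_integrable2 iF) => x ix _.
  by rewrite fineK//; exact: integrable_fin_num.
Qed.

Lemma integrable_Rintegral2 (F : T1 * T2 -> R) :
  (m1 \x m2)%E.-integrable [set: T1 * T2] (EFin \o F) ->
  m2.-integrable [set: T2] (EFin \o (fun y => \int[m1]_x F (x, y))).
Proof.
move=> iF; have mF : measurable_fun setT F.
  by apply/measurable_EFinP; exact: measurable_int iF.
apply: (integrable_Rintegral m2 m1 (fun z => F (z.2, z.1))).
apply/integrable12ltyP.
  apply/measurable_EFinP; apply: measurableT_comp => //.
  exact: measurable_fun_pair.
have mEF : measurable_fun setT (EFin \o F) by exact/measurable_EFinP.
exact: (integrable21ltyP m1 m2 mEF).1.
Qed.

End real_fubini_swap.

Section slices.
Context {d1 d2 d} {T1 : measurableType d1} {T2 : measurableType d2}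
  {T : measurableType d}.

Lemma measurable_section (f : T1 * T2 -> T) t : measurable_fun setT f ->
  measurable_fun setT (fun x => f (t, x)).
Proof.
by move=> mf; apply: (measurableT_comp mf); apply: measurable_fun_pair.
Qed.

Lemma measurable_section2 (f : T1 * T2 -> T) x : measurable_fun setT f ->
  measurable_fun setT (fun t => f (t, x)).
Proof.
by move=> mf; apply: (measurableT_comp mf); apply: measurable_fun_pair.
Qed.

End slices.

Section real_integral.
Context {d} {T : measurableType d} {R : realType} (m : {measure set T -> \bar R}).
Implicit Types f g : T -> R.

Lemma eq_Rintegral_ae f g :
  measurable_fun setT f -> measurable_fun setT g ->
  {ae m, forall x, f x = g x} -> \int[m]_x f x = \int[m]_x g x.
Proof.
move=> mf mg fg; congr fine; apply: ae_eq_integral => //; try exact/measurable_EFinP.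
by apply: filterS fg => x -> _.
Qed.

Lemma integrable_scale (c : R) f : m.-integrable [set: T] (EFin \o f) ->
  m.-integrable [set: T] (EFin \o (fun x => c * f x)).
Proof.
move=> /(integrableZl measurableT c).
by apply: eq_integrable => // x _ /=; rewrite EFinM.
Qed.

Lemma integrable_scaler (c : R) f : m.-integrable [set: T] (EFin \o f) ->
  m.-integrable [set: T] (EFin \o (fun x => f x * c)).
Proof.
move=> /(integrableZr measurableT c).
by apply: eq_integrable => // x _ /=; rewrite EFinM.
Qed.

Lemma integrable_le f g : measurable_fun setT f ->
  m.-integrable [set: T] (EFin \o g) -> (forall x, `|f x| <= g x) ->
  m.-integrable [set: T] (EFin \o f).
Proof.
move=> mf ig fg; apply: le_integrable ig => //; first exact/measurable_EFinP.
by move=> x _ /=; rewrite lee_fin (le_trans (fg x))// ler_norm.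
Qed.

Lemma integrable_mul_bounded f g (C : R) : m.-integrable [set: T] (EFin \o f) ->
  measurable_fun setT g -> (forall x, `|g x| <= C) ->
  m.-integrable [set: T] (EFin \o (fun x => f x * g x)).
Proof.
move=> /[dup] itf /measurable_int/measurable_EFinP mf mg gC.
apply: (integrable_le _ (fun x => C * `|f x|)).
- exact: measurable_funM.
- exact: (integrable_scale C _ (integrable_norm itf)).
- by move=> x; rewrite normrM mulrC ler_wpM2r.
Qed.

Lemma Rintegral_abs_le f g : m.-integrable [set: T] (EFin \o g) ->
  measurable_fun setT f -> (forall x, `|f x| <= g x) ->
  `|\int[m]_x f x| <= \int[m]_x g x.
Proof.
move=> ig mf fg; have itf := integrable_le _ _ mf ig fg.
rewrite (le_trans (le_normr_Rintegral _ itf))// le_Rintegral//.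
exact: integrable_norm.
Qed.

Lemma Rintegral_cvg0 (f_ : nat -> T -> R) g : (forall n, measurable_fun setT (f_ n)) ->
  m.-integrable [set: T] (EFin \o g) ->
  {ae m, forall x, forall n, `|f_ n x| <= g x} ->
  {ae m, forall x, f_ n x @[n --> \oo] --> (0 : R)} ->
  \int[m]_x f_ n x @[n --> \oo] --> (0 : R).
Proof.
move=> mf ig fg f0.
have [] := @dominated_convergence _ _ _ m setT measurableT
  (fun n => EFin \o f_ n) (cst 0%E) (EFin \o g) _ _ _ ig _.
- by move=> n; exact/measurable_EFinP.
- exact: measurable_cst.
- by apply: filterS f0 => x fx _; apply: cvg_EFin fx; exact: nearW.
- by apply: filterS fg => x fgx n _ /=; rewrite lee_fin.
move=> _ _; rewrite integral0 => /fine_cvg.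
by apply: cvg_trans; apply: near_eq_cvg; exact: nearW.
Qed.

Lemma Rintegral_EFin f : m.-integrable [set: T] (EFin \o f) ->
  (\int[m]_x (f x)%:E)%E = (\int[m]_x f x)%:E.
Proof. by move=> itf; rewrite /Rintegral fineK//; exact: integrable_fin_num. Qed.

End real_integral.
Arguments integrable_scale {d T R m} c {f} _.
Arguments integrable_scaler {d T R m} c {f} _.

Section integrable_tensor.
Context {d1 d2} {T1 : measurableType d1} {T2 : measurableType d2} {R : realType}.
Variables (m1 : {sigma_finite_measure set T1 -> \bar R})
  (m2 : {sigma_finite_measure set T2 -> \bar R}).

Lemma integrable_tensor (f1 : T1 -> R) (f2 : T2 -> R) (h : T1 * T2 -> R) (C : R) :
  m1.-integrable [set: T1] (EFin \o f1) ->
  m2.-integrable [set: T2] (EFin \o f2) ->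
  measurable_fun setT h -> (forall z, `|h z| <= C) ->
  (m1 \x m2)%E.-integrable [set: T1 * T2]
    (EFin \o (fun z => f1 z.1 * f2 z.2 * h z)).
Proof.
move=> i1 i2 mh hC.
have mf1 : measurable_fun setT f1 by apply/measurable_EFinP; exact: measurable_int i1.
have mf2 : measurable_fun setT f2 by apply/measurable_EFinP; exact: measurable_int i2.
pose A := \int[m2]_y (C * `|f2 y|).
have iC : m2.-integrable setT (EFin \o (fun y => C * `|f2 y|)).
  exact: (integrable_scale C (integrable_norm i2)).
apply: (integrable_prod _ _ _ (fun x => A * `|f1 x|)).
- apply: measurable_funM => //; apply: measurable_funM; exact: measurableT_comp.
- exact: (integrable_scale A (integrable_norm i1)).
- move=> x /=.
  have mhx : measurable_fun setT (fun y => h (x, y)).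
    apply: (measurableT_comp mh); apply: measurable_fun_pair => //.
  rewrite mulrC EFinM -(Rintegral_EFin _ _ iC) -integralZl//.
  apply: ge0_le_integral => //.
  + apply/measurable_EFinP; apply: measurableT_comp => //.
    by apply: measurable_funM => //; exact: measurable_funM.
  + apply/measurable_EFinP; apply: measurable_funM => //.
    by apply: measurable_funM => //; exact: measurableT_comp.
  + move=> y _; rewrite -EFinM lee_fin !normrM -mulrA ler_wpM2l// mulrC.
    by rewrite ler_wpM2r.
Qed.

End integrable_tensor.

Section indicator.
Context {d} {T : measurableType d} {R : realType}.

Lemma measurable_natr_bool (f : T -> bool) : measurable_fun setT f ->
  measurable_fun setT (fun x => (f x)%:R : R).
Proof.
move=> mf; rewrite (_ : (fun x => _) = (fun x => if f x then 1 else 0 : R)).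
  by apply: measurable_fun_ifT => //; exact: measurable_cst.
by apply/funext => x; case: (f x).
Qed.

Lemma normr_natr_bool_le1 (b : bool) : `|b%:R| <= 1 :> R.
Proof. by case: b; rewrite ?normr1// normr0. Qed.

End indicator.

(** * Correlations *)

Section correlation.
Context {R : realType}.
Local Notation mu := (@lebesgue_measure R).
Implicit Types (f q : R -> R) (r : R).

(** For f = q this is the autocorrelation of f, a function of x - x' only. The
    two-point form displays the factorization over y behind positive
    definiteness. *)
Definition corr f q x x' : R := \int[mu]_y (f (x + y) * q (x' + y)).

Lemma corrC f q x x' : corr f q x x' = corr q f x' x.
Proof. by apply: eq_Rintegral => y _; rewrite mulrC. Qed.

Lemma continuous_translate f x : continuous f -> continuous (fun y => f (x + y)).
Proof.
move=> cf y; apply: (@continuous_comp _ _ _ (fun y => x + y) f); last exact: cf.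
by apply: cvgD; [exact: cvg_cst|exact: cvg_id].
Qed.

Lemma continuous_corr_integrand f q x x' : continuous f -> continuous q ->
  continuous (fun y => f (x + y) * q (x' + y)).
Proof.
by move=> cf cq y; apply: cvgM; exact: continuous_translate.
Qed.

Lemma supp_in_translate a b f x : supp_in a b f ->
  supp_in (a - x) (b - x) (fun y => f (x + y)).
Proof. by move=> fab y; rewrite lerBlDl lerBrDl; exact: fab. Qed.

Lemma supp_in_mulr a b (f g : R -> R) : supp_in a b g ->
  supp_in a b (fun y => f y * g y).
Proof. by move=> gab y /gab ->; rewrite mulr0. Qed.

Lemma integrable_corr a b f q x x' : continuous f -> continuous q ->
  supp_in a b q ->
  mu.-integrable [set: R] (EFin \o (fun y => f (x + y) * q (x' + y))).
Proof.
move=> cf cq qab; apply: (integrable_supp_in (a - x') (b - x')).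
  exact: continuous_corr_integrand.
by apply: supp_in_mulr; exact: supp_in_translate.
Qed.

Lemma integrable_translate a b q x : continuous q -> supp_in a b q ->
  mu.-integrable [set: R] (EFin \o (fun y => q (x + y))).
Proof.
move=> cq qab; apply: integrable_supp_in (supp_in_translate _ _ _ x qab).
exact: continuous_translate.
Qed.

Lemma is_derive_translate f (x y : R) : smooth f ->
  derivable (fun x => f (x + y)) x 1 /\
  derive1 (fun x => f (x + y)) x = 'D_1 f (x + y).
Proof.
move=> sf; rewrite derive1E.
have A (c v p : R) : (fun x : R => x + y) (c *: v + p) = c *: id v + (fun x : R => x + y) p.
  by rewrite addrA.
split.
  by apply: (@derivable_comp_affine _ _ _ (fun x => x + y) id A); exact: smooth_derivable.
exact: (@derive_comp_affine _ _ _ (fun x => x + y) id A).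
Qed.

(** Differentiation under the integral sign, dominated by a multiple of the
    translate of q. *)
Lemma derive_corr a b c d f q x x' : smooth f -> supp_in a b f ->
    continuous q -> supp_in c d q ->
  derivable (corr f q ^~ x') x 1 /\
  'D_1 (corr f q ^~ x') x = corr ('D_1 f) q x x'.
Proof.
move=> sf fab cq qcd; rewrite -derive1E.
have cDf : continuous ('D_1 f : R -> R).
  exact/smooth_continuous/smooth_derive.
have [C C0 DfC] := continuous_supp_in_bounded _ _ _ cDf (supp_in_derive _ _ _ fab).
have fC : (continuous f) by exact: smooth_continuous.
pose F u y := f (u + y) * q (x' + y).
pose G y := C * `|q (x' + y)|.
have dF u y : derivable (F^~ y) u 1 /\ derive1 (F^~ y) u = 'D_1 f (u + y) * q (x' + y).
  have [d1 d2] := is_derive_translate f u y sf; rewrite derive1E in d2.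
  have dc : derivable (cst (q (x' + y)) : R -> R) u 1 by exact: derivable_cst.
  split; first exact: (derivableM d1 dc).
  rewrite derive1E [LHS](deriveM d1 dc) derive_cst scaler0 add0r d2.
  by rewrite /GRing.scale/= mulrC.
have xI : `]x - 1, x + 1[%classic x by rewrite /= in_itv/=; apply/andP; split; lra.
have iF u : `]x - 1, x + 1[%classic u -> mu.-integrable setT (EFin \o F u).
  by move=> _; exact: integrable_corr qcd.
have G0 y : 0 <= G y by rewrite mulr_ge0.
have iG : mu.-integrable setT (EFin \o G).
  exact: (integrable_scale C (integrable_norm (integrable_translate _ _ _ x' cq qcd))).
have dFG u y : `]x - 1, x + 1[%classic u -> setT y -> `|partial1of2 F u y| <= G y.
  by move=> _ _; rewrite /partial1of2 (dF u y).2 normrM ler_wpM2r.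
have dF1 u y : `]x - 1, x + 1[%classic u -> setT y -> derivable (F^~ y) u 1.
  by move=> _ _; exact: (dF u y).1.
split.
  exact: (derivable_under_integral measurableT xI iF dF1 G0 iG dFG).
rewrite (differentiation_under_integral measurableT xI iF dF1 G0 iG dFG).
by apply: eq_Rintegral => y _; rewrite /partial1of2 (dF x y).2.
Qed.

Lemma smooth_corr a b c d f q x' : smooth f -> supp_in a b f ->
  continuous q -> supp_in c d q -> smooth (corr f q ^~ x').
Proof.
move=> + + cq qcd n; elim: n f => [|n IHn] f sf fab.
  move=> x; apply: differentiable_continuous; apply/derivable1_diffP.
  by have [] := derive_corr _ _ _ _ _ _ x x' sf fab cq qcd.
apply: is_CnS_line => [x|].
  by have [] := derive_corr _ _ _ _ _ _ x x' sf fab cq qcd.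
rewrite (_ : 'D_(1 : R) _ = corr ('D_1 f) q ^~ x').
  by apply: IHn; [exact: smooth_derive|exact: supp_in_derive].
by apply/funext => x; have [] := derive_corr _ _ _ _ _ _ x x' sf fab cq qcd.
Qed.

(** Integration by parts in y: the sum of the two correlations is the integral
    of the y-derivative of f(x + y) q(x' + y). *)
Lemma corr_ibp a b f q x x' : smooth f -> smooth q -> supp_in a b q ->
  corr ('D_1 f) q x x' = - corr f ('D_1 q) x x'.
Proof.
move=> sf sq qab.
have cf := smooth_continuous _ sf; have cq := smooth_continuous _ sq.
have cDf : continuous ('D_1 f : R -> R) by exact/smooth_continuous/smooth_derive.
have cDq : continuous ('D_1 q : R -> R) by exact/smooth_continuous/smooth_derive.
have Dqab := supp_in_derive _ _ _ qab.
apply/eqP; rewrite -addr_eq0 /corr -RintegralD//; last 2 first.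
- exact: (integrable_corr a b _ _ _ _ cDf cq qab).
- exact: (integrable_corr a b _ _ _ _ cf cDq Dqab).
pose A (x : R) (y : R) := 1 * y + x.
have sA (h : R -> R) z : smooth h -> smooth (h \o A z).
  apply: (@smooth_comp_affine _ _ _ _ id) => [|c v p]; first exact: continuous_affine.
  by rewrite /A !mul1r addrA.
have DA (h : R -> R) z (y : R) : 'D_1 (h \o A z) y = 'D_1 h (z + y).
  rewrite (@derive_comp_affine _ _ _ (A z) id) => [|c v p].
    by rewrite /A mul1r addrC.
  by rewrite /A !mul1r addrA.
have sF : smooth ((f \o A x) \* (q \o A x')) by apply: smoothM; exact: sA.
have F0 : supp_in (a - x') (b - x') ((f \o A x) \* (q \o A x')).
  apply: supp_in_mulr; have := supp_in_translate _ _ _ x' qab.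
  by congr supp_in; apply/funext => y; rewrite /A/= mul1r addrC.
apply/eqP; rewrite -[RHS](Rintegral_derive_supp_in _ _ _ sF F0).
apply: eq_Rintegral => y _.
rewrite [RHS]deriveM; last 2 first.
- exact/smooth_derivable/sA.
- exact/smooth_derivable/sA.
by rewrite !DA /A/= /GRing.scale/= !mul1r addrC ![y + _]addrC [X in _ + X]mulrC.
Qed.

Lemma supp_in_corr r f q x' : supp_in (- r) r f -> supp_in (- r) r q ->
  supp_in (x' - 2 * r) (x' + 2 * r) (corr f q ^~ x').
Proof.
move=> fr qr x xx'; rewrite /corr (@eq_Rintegral _ _ _ mu _ (cst 0)).
  by rewrite Rintegral_cst// mul0r.
move=> y _ /=; have [/andP[y1 y2]|/fr->] := boolP (- r <= x + y <= r); last by rewrite mul0r.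
rewrite qr ?mulr0//; apply: contra xx' => /andP[y3 y4]; apply/andP; split; lra.
Qed.

Lemma measurable_corr f q : continuous f -> continuous q ->
  measurable_fun [set: R * R] (fun z => corr f q z.1 z.2).
Proof.
move=> cf cq; apply: (measurable_Rintegral mu
  (fun z : (R * R) * R => f (z.1.1 + z.2) * q (z.1.2 + z.2))).
apply: measurable_funM.
  apply: measurableT_comp; first exact: continuous_measurable_fun.
  by apply: measurable_funD => //; apply: measurableT_comp.
apply: measurableT_comp; first exact: continuous_measurable_fun.
by apply: measurable_funD => //; apply: measurableT_comp.
Qed.

End correlation.

(** * Lebesgue points and the fundamental lemma of the calculus of variations *)

Section interval_bounds.
Context {R : realType}.
Local Notation mu := (@lebesgue_measure R).

Let integrable_box (a b c : R) :
  mu.-integrable [set: R] (EFin \o ((cst c) \_ `[a, b])).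
Proof.
rewrite -restrict_EFin; apply/(integrable_mkcond _ _).1 => //.
apply: continuous_compact_integrable; first exact: segment_compact.
by apply: continuous_subspaceT => x; exact: cvg_cst.
Qed.

Let Rintegral_box (a b c : R) : a <= b ->
  \int[mu]_y ((cst c) \_ `[a, b]) y = c * (b - a).
Proof.
move=> ab; rewrite -Rintegral_mkcond Rintegral_cst//= lebesgue_measure_itv/= lte_fin.
move: ab; rewrite le_eqVlt => /predU1P[->|ab]; first by rewrite ltxx subrr.
by rewrite ab.
Qed.

Lemma Rintegral_ge_itv (g : R -> R) (a b c : R) : a <= b ->
  mu.-integrable [set: R] (EFin \o g) -> (forall y, 0 <= g y) ->
  (forall y, a <= y <= b -> c <= g y) -> c * (b - a) <= \int[mu]_y g y.
Proof.
move=> ab ig g0 cg; rewrite -Rintegral_box//.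
apply: le_Rintegral => // y _; rewrite patchE; case: ifPn => //.
by rewrite inE/= in_itv/=; exact: cg.
Qed.

Lemma Rintegral_le_itv (g : R -> R) (a b c : R) : a <= b ->
  measurable_fun setT g -> (forall y, `|g y| <= c) -> supp_in a b g ->
  `|\int[mu]_y g y| <= c * (b - a).
Proof.
move=> ab mg gc gab; rewrite -Rintegral_box//.
apply: Rintegral_abs_le => // y; rewrite patchE; case: ifPn => //.
by rewrite notin_setE/= in_itv/= => /negP/gab ->; rewrite normr0.
Qed.

End interval_bounds.

Section lebesgue_points.
Context {R : realType}.
Local Notation mu := (@lebesgue_measure R).
Implicit Types (f : R -> R).

Lemma bounded_locally_integrable f (M : R) : measurable_fun setT f ->
  (forall x, `|f x| <= M) -> locally_integrable setT f.
Proof.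
move=> mf fM; split=> //; first exact: openT.
move=> K _ cK.
have mK : measurable K by exact: compact_measurable.
have : mu.-integrable K (EFin \o f).
  apply: measurable_bounded_integrable => //.
  - exact: compact_finite_measure.
  - exact: measurable_funS mf.
  - exists M; split=> [|A MA x _]; first exact: num_real.
    exact: le_trans (fM x) (ltW MA).
by move=> /integrableP[].
Qed.

Lemma integrable_ball_bounded f (M x r : R) : measurable_fun setT f ->
  (forall x, `|f x| <= M) -> mu.-integrable (ball x r) (EFin \o f).
Proof.
move=> mf fM; apply: measurable_bounded_integrable => //.
- exact: measurable_ball.
- have [r0|r0] := leP 0 r; first by rewrite /= lebesgue_measure_ball// ltry.
  by rewrite (ball0 _ _).2 ?measure0 // ltW.
- exact: measurable_funS mf.
- exists M; split=> [|A MA y _]; first exact: num_real.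
  exact: le_trans (fM y) (ltW MA).
Qed.

(** Averages over balls of radius r are taken here with respect to r instead
    of the measure 2 r of the ball. *)
Lemma lebesgue_pt_Rintegral f (M x : R) : measurable_fun setT f ->
  (forall x, `|f x| <= M) -> lebesgue_pt f x ->
  r^-1 * \int[mu]_(y in ball x r) `|f y - f x| @[r --> 0^'+] --> (0 : R).
Proof.
move=> mf fM /fine_cvgP[_] xf.
have xf2 : 2 * fine (davg f x r) @[r --> 0^'+] --> 2 * (0 : R).
  by apply: cvgM; [exact: cvg_cst|exact: xf].
rewrite -[X in _ --> X](mulr0 2); apply: cvg_trans xf2.
apply: near_eq_cvg; near=> r => /=.
have r0 : 0 < r by near: r; exact: nbhs_right_gt.
rewrite /davg/= /iavg/= (lebesgue_measure_ball _ (ltW r0)).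
have iB : mu.-integrable (ball x r) (EFin \o (fun y => `|f y - f x|)).
  apply: integrable_norm; apply: (@integrable_ball_bounded _ (M + M)).
    by apply: measurable_funB => //; exact: measurable_cst.
  by move=> y; rewrite (le_trans (ler_normB _ _))// lerD.
rewrite (_ : (\int[mu]_(y in ball x r) _)%E =
    (\int[mu]_(y in ball x r) `|f y - f x|)%R%:E); last first.
  by rewrite /Rintegral fineK//; apply: integrable_fin_num iB; exact: measurable_ball.
rewrite inver mulrn_eq0/= gt_eqF//= -[r *+ 2]mulr_natr.
by field; rewrite gt_eqF.
Unshelve. all: by end_near. Qed.

(** The fundamental lemma of the calculus of variations. Let f x <> 0 at a
    Lebesgue point x, and let g be a bump of radius r at x. The integral of f g
    differs from f x times that of g by at most the oscillation of f on the
    ball, which is o(r), while |f x| times the integral of g is at least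
    c r |f x|; for small r this contradicts orthogonality. *)
Lemma orthogonal_bumps_ae0 f (M T : R) : measurable_fun setT f ->
    (forall x, `|f x| <= M) ->
    (forall (g : R -> R) a b, smooth g -> 0 < a -> a < b -> b < T ->
      supp_in a b g -> \int[mu]_x (f x * g x) = 0) ->
  {ae mu, forall x, 0 < x < T -> f x = 0}.
Proof.
move=> mf fM fg0.
have := lebesgue_differentiation (bounded_locally_integrable _ _ mf fM).
apply: filterS; first exact: (ae_filter_ringOfSetsType mu).
move=> x /(lebesgue_pt_Rintegral _ _ _ mf fM) fx /andP[x0 xT].
apply/eqP; apply: contrapT => /negP fx0.
have [c c0 bump] := @bump_exists R.
have e0 : 0 < c * `|f x| by rewrite mulr_gt0// normr_gt0.
have [r [r0 rx rT rf]] : exists r : R, [/\ 0 < r, r < x, r < T - x &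
    \int[mu]_(y in ball x r) `|f y - f x| < r * (c * `|f x|)].
  have : \forall r \near 0^'+, [/\ 0 < r, r < x, r < T - x &
    \int[mu]_(y in ball x r) `|f y - f x| < r * (c * `|f x|)].
    near=> r; have r0 : 0 < r by near: r; exact: nbhs_right_gt.
    split=> //.
    - by near: r; apply: nbhs_right_lt; rewrite subr_gt0.
    - rewrite mulrC -ltr_pdivrMr// mulrC.
      near: r; exact: (cvgr_lt 0 fx).
  move=> /filter_ex[r [? ? ? ?]]; by exists r.
have [k [sk k01 kr kc]] := bump _ r0.
pose g y := k (y - x).
have sg : smooth g.
  apply: (@smooth_comp_affine _ _ _ (fun y => y - x) id _ _ k) => //.
    by move=> y; apply: cvgB; [exact: cvg_id|exact: cvg_cst].
  by move=> s v p /=; rewrite addrA.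
have gs : supp_in (x - r) (x + r) g.
  move=> y; rewrite /g => yr; apply: kr; rewrite leNgt; apply: contra yr.
  by rewrite ltr_norml => /andP[y1 y2]; apply/andP; split; lra.
have := fg0 g (x - r) (x + r) sg; rewrite subr_gt0 => /(_ rx).
have -> : (x - r < x + r) = true by lra.
have -> : (x + r < T) = true by lra.
move=> /(_ isT isT gs) fg.
have ig : mu.-integrable setT (EFin \o g).
  by apply: integrable_supp_in gs; exact: smooth_continuous.
have g1 y : `|g y| <= 1 by rewrite ger0_norm; have /andP[] := k01 (y - x).
have mg : measurable_fun setT g by apply: continuous_measurable_fun; exact: smooth_continuous.
have g_ge : c * r <= \int[mu]_y g y.
  rewrite [X in c * X](_ : r = (x + r / 2) - (x - r / 2)); last by field.
  apply: Rintegral_ge_itv => //.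
  - by lra.
  - by move=> y; have /andP[] := k01 (y - x).
  - by move=> y /andP[y1 y2]; apply: kc; rewrite ler_norml; apply/andP; split; lra.
have : `|f x| * \int[mu]_y g y <= \int[mu]_(y in ball x r) `|f y - f x|.
  have g0 : 0 <= \int[mu]_y g y by apply: le_trans g_ge; rewrite mulr_ge0// ltW.
  rewrite -[X in _ * X](ger0_norm g0) -normrM -RintegralZl//.
  have ifg (h : R -> R) (C : R) : measurable_fun setT h -> (forall x, `|h x| <= C) ->
      mu.-integrable setT (EFin \o (fun y => h y * g y)).
    move=> mh hC; have := integrable_mul_bounded _ _ _ _ ig mh hC.
    by apply: eq_integrable => // y _ /=; rewrite mulrC.
  rewrite -[X in `|X|]subr0 -fg -RintegralB//; last 2 first.
  - by apply: ifg => //; exact: measurable_cst.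
  - exact: ifg fM.
  have mfx : measurable_fun setT (fun y => f y - f x).
    by apply: measurable_funB => //; exact: measurable_cst.
  rewrite [leRHS]Rintegral_mkcond; apply: Rintegral_abs_le.
  - rewrite -restrict_EFin; apply/(integrable_mkcond _ _).1; first exact: measurable_ball.
    apply: integrable_norm; apply: (@integrable_ball_bounded _ (M + M)) => //.
    by move=> y; rewrite (le_trans (ler_normB _ _))// lerD.
  - by apply: measurable_funB; apply: measurable_funM => //; exact: measurable_cst.
  - move=> y; rewrite -mulrBl normrM distrC patchE; case: ifPn => [_|].
      by rewrite ler_piMr.
    rewrite notin_setE ball_itv/= in_itv/= => /negP yr.
    rewrite /g kr ?normr0 ?mulr0// leNgt; apply: contra yr.
    by rewrite ltr_norml => /andP[y1 y2]; apply/andP; split; lra.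
move=> /le_lt_trans/(_ rf); rewrite ltNge => /negP; apply.
by rewrite mulrA [r * c]mulrC [leLHS]mulrC ler_wpM2l.
Unshelve. all: by end_near. Qed.
End lebesgue_points.

(** * Weak evolution equations in one real variable *)

Section du_bois_reymond.
Context {R : realType}.
Local Notation mu := (@lebesgue_measure R).
Implicit Types (a b f g : R -> R) (T M : R).

Lemma measurable_fun_smooth f : smooth f -> measurable_fun setT f.
Proof. by move=> sf; apply: continuous_measurable_fun; exact: smooth_continuous. Qed.

(** The compensator used in the next proof: a unit mass at negative
    times, invisible to functions that vanish there. *)
Lemma unit_mass_bump_before0 : exists k : R -> R,
  [/\ smooth k, supp_in (- 3) (- 1) k & \int[mu]_x k x = 1].
Proof.
have [c c0 bump] := @bump_exists R.
have [k [sk k01 k1 kc]] := bump 1 ltr01.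
pose g y := k (y + 2).
have sg : smooth g.
  apply: (@smooth_comp_affine R R R (fun y : R => y + 2) id _ _ k) => //.
    by move=> y; apply: cvgD; [exact: cvg_id|exact: cvg_cst].
  by move=> s v p; rewrite -[LHS]addrA.
have gs : supp_in (- 3) (- 1) g.
  move=> y; rewrite /g => yr; apply: k1; rewrite leNgt; apply: contra yr.
  by rewrite ltr_norml => /andP[y1 y2]; apply/andP; split; lra.
have ig : mu.-integrable setT (EFin \o g).
  by apply: integrable_supp_in gs; exact: smooth_continuous.
have I0 : 0 < \int[mu]_x g x.
  apply: (@lt_le_trans _ _ (c * (- 3 / 2 - (- 5 / 2)))).
    by rewrite mulr_gt0//; lra.
  apply: Rintegral_ge_itv => //; first by lra.
    by move=> y; have /andP[] := k01 (y + 2).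
  by move=> y /andP[y1 y2]; apply: kc; rewrite ler_norml; apply/andP; split; lra.
exists (fun x => (\int[mu]_x g x)^-1 * g x); split.
- by move=> n; apply: is_CnZ; exact: sg.
- exact: supp_in_mulr.
- by rewrite RintegralZl// mulVf// gt_eqF.
Qed.

(** The hypothesis on theta is the weak form of a' = b with a = 0 at time 0:
    as theta need not vanish at 0, the initial value is tested too. To show
    that a minus the primitive of b is orthogonal to a bump f, the hypothesis
    is applied to a primitive of f. *)
Lemma du_bois_reymond T M a b : measurable_fun setT a ->
    (forall t, `|a t| <= M) -> supp_in 0 T a ->
    mu.-integrable [set: R] (EFin \o b) -> supp_in 0 T b ->
    (forall (theta : R -> R) c d, smooth theta -> supp_in c d theta -> d < T ->
      \int[mu]_t (a t * 'D_1 theta t) + \int[mu]_t (b t * theta t) = 0) ->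
  {ae mu, forall t, 0 < t < T ->
    a t = \int[mu]_s (b s * (s < t)%R%:R)}.
Proof.
move=> ma aM aT ib bT weak.
have mb : measurable_fun setT b by apply/measurable_EFinP; exact: measurable_int ib.
have mlt : measurable_fun [set: R * R] (fun z : R * R => (z.1 < z.2)%R%:R : R).
  by apply: measurable_natr_bool; apply: measurable_fun_ltr.
pose B (t : R) : R := \int[mu]_s (b s * (s < t)%R%:R).
have mB : measurable_fun setT B.
  apply: (measurable_Rintegral mu (fun z : R * R => b z.2 * (z.2 < z.1)%R%:R)).
  apply: measurable_funM; first exact: measurableT_comp.
  by apply: measurable_natr_bool; apply: measurable_fun_ltr.
have mltt (t : R) : measurable_fun setT (fun s : R => (s < t)%R%:R : R).
  by apply: measurable_natr_bool; apply: measurable_fun_ltr => //; exact: measurable_cst.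
have mgt (t : R) : measurable_fun setT (fun s : R => (t < s)%R%:R : R).
  by apply: measurable_natr_bool; apply: measurable_fun_ltr => //; exact: measurable_cst.
have BM t : `|B t| <= \int[mu]_s `|b s|.
  apply: Rintegral_abs_le.
  - exact: integrable_norm.
  - by apply: measurable_funM => //; exact: mltt.
  - by move=> s; rewrite normrM ler_piMr// normr_natr_bool_le1.
suff : {ae mu, forall t, 0 < t < T -> a t - B t = 0}.
  apply: filterS; first exact: (ae_filter_ringOfSetsType mu).
  by move=> t aB /aB/eqP; rewrite subr_eq0 => /eqP.
apply: (@orthogonal_bumps_ae0 _ _ (M + \int[mu]_s `|b s|)).
- by apply: measurable_funB.
- by move=> t; rewrite (le_trans (ler_normB _ _))// lerD.
move=> f p q sf p0 pq qT fpq.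
have [k [sk ks k1]] := unit_mass_bump_before0.
have intf : mu.-integrable setT (EFin \o f).
  by apply: integrable_supp_in fpq; exact: smooth_continuous.
have intk : mu.-integrable setT (EFin \o k).
  by apply: integrable_supp_in ks; exact: smooth_continuous.
have mf := measurable_fun_smooth _ sf; have mk := measurable_fun_smooth _ sk.
pose I := \int[mu]_x f x.
(* the correction by a multiple of k, which lives at negative times, makes the
   primitive of f compactly supported *)
pose g := f \+ (fun x => - I * k x).
have sg : smooth g by move=> n; apply: is_CnD; [exact: sf|apply: is_CnZ; exact: sk].
have gs : supp_in (- 3) q g.
  move=> x xq; rewrite /g/= fpq ?ks ?mulr0 ?addr0//.
    by apply: contra xq => /andP[x1 x2]; apply/andP; split; lra.
  by apply: contra xq => /andP[x1 x2]; apply/andP; split; lra.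
have intIk : mu.-integrable setT (EFin \o (fun x => - I * k x)).
  exact: (integrable_scale (- I) intk).
have intg : mu.-integrable setT (EFin \o g).
  by apply: integrable_supp_in gs; exact: smooth_continuous.
have g0 : \int[mu]_x g x = 0.
  by rewrite /g RintegralD// RintegralZl// k1 mulr1 subrr.
have [] := supp_in_primitive _ _ _ sg gs g0.
set F := fun x => _; move=> sF Fs DF.
have : \int[mu]_t (a t * g t) + \int[mu]_t (b t * F t) = 0.
  rewrite -[RHS](weak F _ _ sF Fs qT); congr (_ + _).
  by apply: eq_Rintegral => t _; congr (_ * _); rewrite -DF.
have -> : \int[mu]_t (a t * g t) = \int[mu]_t (a t * f t).
  apply: eq_Rintegral => t _; rewrite /g/=.
  have [/andP[t1 t2]|/ks->] := boolP (- 3 <= t <= - 1); last by rewrite mulr0 addr0.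
  by rewrite aT ?mul0r// ; apply/negP => /andP[t3 t4]; lra.
have Fpos (s : R) : 0 <= s -> F s = - \int[mu]_x (f x * (s < x)%R%:R).
  move=> s0; rewrite /F Rintegral_mkcond.
  have imk (h : R -> R) : mu.-integrable setT (EFin \o h) ->
      mu.-integrable setT (EFin \o (fun x : R => h x * (s < x)%R%:R)).
    move=> ih; apply: (integrable_mul_bounded _ _ _ 1 ih) => [|x].
      exact: mgt.
    exact: normr_natr_bool_le1.
  rewrite (@eq_Rintegral _ _ _ mu _ (fun x : R => g x - f x * (s < x)%R%:R)); last first.
    move=> x _; rewrite patchE; case: ifPn.
      by rewrite inE/= in_itv/= leNgt => /negPf ->; rewrite mulr0 subr0.
    rewrite notin_setE/= in_itv/= => /negP; rewrite -ltNge => sx.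
    rewrite sx mulr1 /g/= ks ?mulr0 ?addr0 ?subrr//.
    by apply/negP => /andP[x1 x2]; lra.
  by rewrite RintegralB// ?g0 ?sub0r//; exact: imk.
have -> : \int[mu]_t (b t * F t) = \int[mu]_s \int[mu]_x (- (b s * f x * (s < x)%R%:R)).
  apply: eq_Rintegral => s _.
  have [/andP[s0 sT]|/bT->] := boolP (0 <= s <= T); last first.
    rewrite mul0r (@eq_Rintegral _ _ _ mu _ (cst 0)) ?Rintegral_cst ?mul0r//.
    by move=> x _; rewrite !mul0r oppr0.
  have imk : mu.-integrable setT (EFin \o (fun x : R => f x * (s < x)%R%:R)).
    apply: (integrable_mul_bounded _ _ _ 1 intf) => [|x].
      exact: mgt.
    exact: normr_natr_bool_le1.
  rewrite (Fpos _ s0) mulrN -mulNr -RintegralZl//.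
  by apply: eq_Rintegral => x _; rewrite mulrA !mulNr.
rewrite (RFubini mu mu (fun z : R * R => - (b z.1 * f z.2 * (z.1 < z.2)%R%:R))); last first.
  have := @integrable_tensor _ _ _ _ _ mu mu b f
    (fun z : R * R => (z.1 < z.2)%R%:R) 1 ib intf mlt (fun z => normr_natr_bool_le1 _).
  move/integrableN; by apply: eq_integrable.
have iaf : mu.-integrable setT (EFin \o (fun t => a t * f t)).
  have := integrable_mul_bounded _ _ _ _ intf ma aM.
  by apply: eq_integrable => // t _ /=; rewrite mulrC.
have iBf : mu.-integrable setT (EFin \o (fun t => B t * f t)).
  have := integrable_mul_bounded _ _ _ _ intf mB BM.
  by apply: eq_integrable => // t _ /=; rewrite mulrC.
have ib1 (t : R) : mu.-integrable setT (EFin \o (fun s : R => b s * (s < t)%R%:R)).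
  by apply: (integrable_mul_bounded _ _ _ 1 ib) => [|s]; [exact: mltt|exact: normr_natr_bool_le1].
move=> H; transitivity (\int[mu]_t (a t * f t - B t * f t)).
  by apply: eq_Rintegral => t _; rewrite mulrBl.
rewrite RintegralB// -{}H; congr (_ + _).
rewrite -mulN1r -RintegralZl//; apply: eq_Rintegral => t _ /=.
rewrite mulN1r [B t * f t]mulrC -mulNr -RintegralZl//.
by apply: eq_Rintegral => s _; ring.
Qed.

End du_bois_reymond.

(** * Positive definiteness of autocorrelations *)

Section plane_measure.
Context {R : realType}.
Local Notation mu := (@lebesgue_measure R).

(** Lebesgue measure on the (t, x)-plane, as a constant that carries its own
    sigma-finiteness and can thus be a factor of further products. *)
Definition plane : set (measurableTypeR R * measurableTypeR R) -> \bar R :=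
  (mu \x mu)%E.

HB.instance Definition _ := Measure.on plane.

Let plane_sigma_finite : sigma_finite setT plane.
Proof.
have /sigma_finiteP[F [TF ndF Foo]] := sigma_finiteT mu.
exists (fun n => F n `*` F n).
  rewrite -setXTT TF predeqE => -[x y]; split.
    move=> [/= [n _ Fnx] [k _ Fky]]; exists (maxn n k) => //; split.
    - by move: x Fnx; exact/subsetPset/ndF/leq_maxl.
    - by move: y Fky; exact/subsetPset/ndF/leq_maxr.
  by move=> [n _ []/= ? ?]; split; exists n.
move=> k; have [? ?] := Foo k.
split; first exact: measurableX.
by rewrite /plane product_measure1E// lte_mul_pinfty// ge0_fin_numE.
Qed.

HB.instance Definition _ := Measure_isSigmaFinite.Build _ _ _ plane
  plane_sigma_finite.

End plane_measure.

Section positive_definite.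
Context {R : realType}.
Local Notation mu := (@lebesgue_measure R).
Local Notation mu2 := (@plane R).
Variables (g : R * R -> R) (p : R -> R) (r : R).
Hypothesis ig : mu2.-integrable [set: R * R] (EFin \o g).
Hypotheses (cp : continuous p) (ps : supp_in (- r) r p) (r0 : 0 < r).

Let mg : measurable_fun [set: R * R] g.
Proof. by apply/measurable_EFinP; exact: measurable_int ig. Qed.

Let mpair : measurable_fun [set: (R * R) * R] (fun c : (R * R) * R => p (c.1.2 + c.2)).
Proof.
apply: measurableT_comp; first exact: continuous_measurable_fun.
by apply: measurable_funD => //; apply: measurableT_comp.
Qed.

Let integrable_mixture (P : R -> R) (C : R) : measurable_fun setT P ->
  (forall y, `|P y| <= C) ->
  (mu2 \x mu)%E.-integrable [set: (R * R) * R]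
    (EFin \o (fun c => g c.1 * (P c.2 * p (c.1.2 + c.2)))).
Proof.
move=> mP PC; have [D D0 pD] := continuous_supp_in_bounded _ _ _ cp ps.
have C0 : 0 <= C by exact: le_trans (PC 0).
apply: (integrable_prod mu2 mu _ (fun z => (C * D * (2 * r)) * `|g z|)).
- apply: measurable_funM; first exact: measurableT_comp.
  by apply: measurable_funM => //; exact: measurableT_comp.
- exact: (integrable_scale (C * D * (2 * r)) (integrable_norm ig)).
move=> z /=.
have mh : measurable_fun setT (fun y : R => g z * (P y * p (z.2 + y))).
  apply: measurable_funM => //; apply: measurable_funM => //.
  by apply: continuous_measurable_fun; exact: continuous_translate.
have hs : supp_in (- r - z.2) (r - z.2) (fun y : R => `|g z * (P y * p (z.2 + y))|).
  by move=> y /(supp_in_translate _ _ _ z.2 ps) ->; rewrite !mulr0 normr0.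
have hb (y : R) : `|g z * (P y * p (z.2 + y))| <= `|g z| * (C * D).
  by rewrite !normrM ler_wpM2l// ler_pM.
have ih : mu.-integrable setT (EFin \o (fun y : R => `|g z * (P y * p (z.2 + y))|)).
  apply: integrable_norm.
  rewrite (_ : EFin \o _ = (EFin \o (fun y : R => g z * (P y * p (z.2 + y))))
    \_ `[- r - z.2, r - z.2]); last first.
    apply/funext => y; rewrite patchE; case: ifPn => //=.
    rewrite notin_setE/= in_itv/= => /negP/(supp_in_translate _ _ _ z.2 ps) ->.
    by rewrite !mulr0.
  apply/(integrable_mkcond _ _).1 => //.
  apply: measurable_bounded_integrable => //.
  - by rewrite /= lebesgue_measure_itv/=; case: ifP => //; rewrite -EFinB ltry.
  - exact: measurable_funS mh.
  - exists (`|g z| * (C * D)); split=> [|A MA y _]; first exact: num_real.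
    exact: le_trans (hb y) (ltW MA).
rewrite (Rintegral_EFin _ _ ih) lee_fin.
have zr : - r - z.2 <= r - z.2 by rewrite lerD2r ge0_cp// ltW.
have mah := measurableT_comp (@normr_measurable R setT) mh.
have hb' (y : R) : `| `|g z * (P y * p (z.2 + y))| | <= `|g z| * (C * D).
  by rewrite normr_id.
have := Rintegral_le_itv _ _ _ _ zr mah hb' hs.
move=> /(le_trans (ler_norm _))/le_trans; apply.
by rewrite le_eqVlt; apply/orP; left; apply/eqP; ring.
Qed.

Let mixture_fubini (P : R -> R) (C : R) : measurable_fun setT P ->
  (forall y, `|P y| <= C) ->
  \int[mu]_y (P y * \int[mu2]_z (g z * p (z.2 + y))) =
  \int[mu2]_z (g z * \int[mu]_y (P y * p (z.2 + y))).
Proof.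
move=> mP PC; have [D D0 pD] := continuous_supp_in_bounded _ _ _ cp ps.
have := RFubini mu2 mu _ (integrable_mixture _ _ mP PC) => /= H.
transitivity (\int[mu]_y \int[mu2]_z (g z * (P y * p (z.2 + y)))).
  apply: eq_Rintegral => y _; rewrite -RintegralZl//.
    by apply: eq_Rintegral => z _; rewrite mulrCA.
  apply: (integrable_mul_bounded _ _ _ D ig) => //.
  apply: measurableT_comp; first exact: continuous_measurable_fun.
  by apply: measurable_funD.
rewrite -H; apply: eq_Rintegral => z _.
rewrite RintegralZl//.
have := @integrable_mul_bounded _ _ _ mu (fun y => p (z.2 + y)) P C.
have ip := integrable_translate _ _ _ z.2 cp ps.
move=> /(_ ip mP PC); apply: eq_integrable => // y _ /=.
by rewrite mulrC.
Qed.

(** By Fubini's theorem the quadratic form is the integral over y of the square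
    of the integral of g(z) p(z.2 + y) over z. *)
Lemma corr_positive_definite :
  0 <= \int[mu2]_z (g z * \int[mu2]_z' (g z' * corr p p z'.2 z.2)).
Proof.
have [D D0 pD] := continuous_supp_in_bounded _ _ _ cp ps.
pose P (y : R) : R := \int[mu2]_z (g z * p (z.2 + y)).
have mP : measurable_fun setT P.
  apply: (measurable_Rintegral mu2 (fun c : R * (R * R) => g c.2 * p (c.2.2 + c.1))).
  apply: measurable_funM; first exact: measurableT_comp.
  apply: measurableT_comp; first exact: continuous_measurable_fun.
  by apply: measurable_funD => //; apply: measurableT_comp.
have PC y : `|P y| <= \int[mu2]_z (D * `|g z|).
  apply: Rintegral_abs_le.
  - exact: (integrable_scale D (integrable_norm ig)).
  - apply: measurable_funM => //.
    apply: measurableT_comp; first exact: continuous_measurable_fun.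
    by apply: measurable_funD.
  - by move=> z; rewrite normrM mulrC ler_wpM2r.
rewrite (_ : \int[mu2]_z _ = \int[mu]_y (P y * P y)).
  by apply: Rintegral_ge0 => y _; rewrite -expr2 sqr_ge0.
apply: etrans (esym (mixture_fubini _ _ mP PC)).
apply: eq_Rintegral => z _.
congr (_ * _).
transitivity (\int[mu]_y (p (z.2 + y) * P y)); last first.
  by apply: eq_Rintegral => y _; rewrite mulrC.
have mpz : measurable_fun setT (fun y : R => p (z.2 + y)).
  by apply: continuous_measurable_fun; exact: continuous_translate.
transitivity (\int[mu2]_z' (g z' * \int[mu]_y (p (z.2 + y) * p (z'.2 + y)))).
  by apply: eq_Rintegral => z' _; rewrite corrC.
exact: (esym (mixture_fubini _ _ mpz (fun y => pD (z.2 + y)))).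
Qed.

End positive_definite.

(** * The energy inequality *)

Section energy_inequality.
Context {R : realType}.
Local Notation mu := (@lebesgue_measure R).
Local Notation plane := (@plane R).
Variables (w g : R * R -> R) (M T : R).
Hypotheses (mw : measurable_fun [set: R * R] w) (mg : measurable_fun [set: R * R] g).
Hypotheses (wM : forall z, `|w z| <= M) (gM : forall z, `|g z| <= M).
Hypothesis ig : plane.-integrable [set: R * R] (EFin \o g).
Hypotheses (ws : forall t x, ~~ (0 <= t <= T) -> w (t, x) = 0)
  (gs : forall t x, ~~ (0 <= t <= T) -> g (t, x) = 0).
Hypothesis weak : forall (theta psi : R -> R) (a b c d : R),
  smooth theta -> supp_in a b theta -> b < T -> smooth psi -> supp_in c d psi ->
  \int[mu]_t (\int[mu]_x (w (t, x) * psi x) * 'D_1 theta t) +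
  \int[mu]_t (2^-1 * \int[mu]_x (g (t, x) * 'D_1 ('D_1 psi) x) * theta t) = 0.

(** The equation tested with psi in space is an evolution equation in t for the
    integral of w psi, to which du_bois_reymond applies. The exceptional set of
    times depends on psi. *)
Lemma weak_solution_integrated psi c d : smooth psi -> supp_in c d psi ->
  {ae mu, forall t, 0 < t < T -> \int[mu]_x (w (t, x) * psi x) =
    \int[mu]_s (2^-1 * \int[mu]_x (g (s, x) * 'D_1 ('D_1 psi) x) * (s < t)%R%:R)}.
Proof.
move=> sp pcd.
have ip : mu.-integrable setT (EFin \o psi).
  by apply: integrable_supp_in pcd; exact: smooth_continuous.
have mp := measurable_fun_smooth _ sp.
have sDDp : smooth ('D_1 ('D_1 psi) : R -> R) by do 2 apply: smooth_derive.
have [C C0 DDpC] := continuous_supp_in_bounded _ _ _ (smooth_continuous _ sDDp)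
  (supp_in_derive _ _ _ (supp_in_derive _ _ _ pcd)).
have mDDp := measurable_fun_smooth _ sDDp.
have Z0 (f h : R -> R) : (forall x, f x = 0) -> \int[mu]_x (f x * h x) = 0.
  move=> f0; rewrite (@eq_Rintegral _ _ _ mu _ (cst 0)) ?Rintegral_cst ?mul0r//.
  by move=> x _; rewrite f0 mul0r.
apply: (@du_bois_reymond _ T (\int[mu]_x (M * `|psi x|))).
- apply: (measurable_Rintegral mu (fun z : R * R => w z * psi z.2)).
  by apply: measurable_funM => //; exact: measurableT_comp.
- move=> t; apply: Rintegral_abs_le.
  + exact: (integrable_scale M (integrable_norm ip)).
  + by apply: measurable_funM => //; exact: measurable_section.
  + by move=> x; rewrite normrM ler_wpM2r.
- by move=> t tT; apply: Z0 => x; exact: ws.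
- have iF : plane.-integrable setT
      (EFin \o (fun z : R * R => g z * 'D_1 ('D_1 psi) z.2)).
    apply: (integrable_mul_bounded _ _ _ C ig) => [|z]; last exact: DDpC.
    by apply: (measurableT_comp mDDp).
  exact: (integrable_scale 2^-1 (integrable_Rintegral mu mu _ iF)).
- by move=> t tT; rewrite Z0 ?mulr0// => x; exact: gs.
- by move=> theta a b st ab bT; exact: (weak _ _ _ _ _ _ st ab bT sp pcd).
Qed.

Variables (k : R -> R) (r : R).
Hypotheses (sk : smooth k) (ks : supp_in (- r) r k) (r0 : 0 < r).

Let p : R -> R := 'D_1 k.
Let sp : smooth p. Proof. exact: smooth_derive. Qed.
Let ps : supp_in (- r) r p. Proof. exact: supp_in_derive. Qed.
Let ck := smooth_continuous _ sk.
Let cp := smooth_continuous _ sp.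

Let corr_bounded (q : R -> R) : continuous q -> supp_in (- r) r q ->
  exists2 C, 0 <= C & forall x x', `|corr q q x x'| <= C.
Proof.
move=> cq qs; have [C C0 qC] := continuous_supp_in_bounded _ _ _ cq qs.
exists (C * C * (r - - r)); first by rewrite !mulr_ge0// opprK addr_ge0// ltW.
move=> x x'; rewrite (_ : r - - r = (r - x') - (- r - x')); last by ring.
apply: Rintegral_le_itv.
- by rewrite lerD2r ge0_cp// ltW.
- by apply: continuous_measurable_fun; exact: continuous_corr_integrand.
- by move=> y; rewrite normrM ler_pM.
- by apply: supp_in_mulr; exact: supp_in_translate.
Qed.

(** The autocorrelation of k' applied to g, restricted to earlier times. *)
Let V (z' : R * R) : R :=
  \int[plane]_z (g z * (corr p p z.2 z'.2 * (z.1 < z'.1)%R%:R)).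

Let mtime : measurable_fun [set: (R * R) * (R * R)]
  (fun c : (R * R) * (R * R) => (c.2.1 < c.1.1)%R%:R : R).
Proof.
apply: measurable_natr_bool; apply: measurable_fun_ltr;
 by apply: measurableT_comp.
Qed.

Let mcorr2 : measurable_fun [set: (R * R) * (R * R)]
  (fun c : (R * R) * (R * R) => corr p p c.2.2 c.1.2 : R).
Proof.
apply: (@measurableT_comp _ _ _ _ _ _ (fun z : R * R => corr p p z.1 z.2) _
  (fun c : (R * R) * (R * R) => (c.2.2, c.1.2))).
  exact: measurable_corr.
by apply: measurable_fun_pair; apply: measurableT_comp.
Qed.

Let mV : measurable_fun [set: R * R] V.
Proof.
apply: (measurable_Rintegral plane (fun c : (R * R) * (R * R) =>
  g c.2 * (corr p p c.2.2 c.1.2 * (c.2.1 < c.1.1)%R%:R))).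
apply: measurable_funM; first exact: measurableT_comp.
exact: measurable_funM.
Qed.

Let mpairl (z' : R * R) : measurable_fun setT (fun z : R * R => (z', z)).
Proof. exact: measurable_fun_pair. Qed.

Let V_bounded : exists C, forall z, `|V z| <= C.
Proof.
have [C C0 pC] := corr_bounded _ cp ps.
exists (\int[plane]_z (C * `|g z|)) => z'; apply: Rintegral_abs_le.
- exact: (integrable_scale C (integrable_norm ig)).
- apply: measurable_funM => //; apply: measurable_funM.
    exact: (measurableT_comp mcorr2 (mpairl z')).
  exact: (measurableT_comp mtime (mpairl z')).
- move=> z; rewrite normrM mulrC ler_wpM2r// normrM -[leRHS]mulr1 ler_pM//.
  exact: normr_natr_bool_le1.
Qed.

Let mq (z' : R * R) :
  measurable_fun [set: R * R] (fun z : R * R => corr p p z.2 z'.2).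
Proof. exact: (measurableT_comp mcorr2 (mpairl z')). Qed.

Let ae_other_time (t : R) : {ae plane, forall z : R * R, z.1 <> t}.
Proof.
exists ([set t] `*` setT); split.
- exact: measurableX.
- by rewrite /plane/= product_measure1E//= lebesgue_measure_set1 mul0e.
- by move=> [s x] /= /contrapT ->.
Qed.

(** Exchanging z and z' turns the restriction to earlier times into the
    restriction to later ones. Coinciding times form a null set, so twice the
    restricted quadratic form is the full one. *)
Let V_sum_ge0 : 0 <= \int[plane]_z (g z * V z).
Proof.
have [C C0 pC] := corr_bounded _ cp ps.
pose H (c : (R * R) * (R * R)) : R :=
  g c.1 * g c.2 * (corr p p c.2.2 c.1.2 * (c.2.1 < c.1.1)%R%:R).
have iH : (plane \x plane)%E.-integrable setT (EFin \o H).
  apply: (integrable_tensor plane plane _ _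
    (fun c => corr p p c.2.2 c.1.2 * (c.2.1 < c.1.1)%R%:R) C ig ig).
  - exact: measurable_funM.
  - move=> c; rewrite normrM -[leRHS]mulr1 ler_pM//.
    exact: normr_natr_bool_le1.
have iH' (z' : R * R) (f : R * R -> bool) : measurable_fun setT f ->
    plane.-integrable setT
      (EFin \o (fun z => g z * (corr p p z.2 z'.2 * (f z)%:R))).
  move=> mf; apply: (integrable_mul_bounded _ _ _ C ig).
    by apply: measurable_funM; [exact: mq|exact: measurable_natr_bool].
  move=> z; rewrite normrM -[leRHS]mulr1 ler_pM//.
  exact: normr_natr_bool_le1.
have mlt1 (t : R) : measurable_fun setT (fun z : R * R => (z.1 < t)%R).
  by apply: measurable_fun_ltr => //; exact: measurable_cst.
have mlt2 (t : R) : measurable_fun setT (fun z : R * R => (t < z.1)%R).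
  by apply: measurable_fun_ltr => //; exact: measurable_cst.
pose before (z' : R * R) : R :=
  \int[plane]_z (g z * (corr p p z.2 z'.2 * (z.1 < z'.1)%R%:R)).
pose after (z' : R * R) : R :=
  \int[plane]_z (g z * (corr p p z.2 z'.2 * (z'.1 < z.1)%R%:R)).
have HE z' : \int[plane]_z H (z', z) = g z' * before z'.
  transitivity (\int[plane]_z (g z' * (g z *
      (corr p p z.2 z'.2 * (z.1 < z'.1)%R%:R)))).
    by apply: eq_Rintegral => z _; rewrite /H/= [RHS]mulrA.
  exact: (RintegralZl _ measurableT (iH' z' _ (mlt1 z'.1))).
have HE' z' : \int[plane]_z H (z, z') = g z' * after z'.
  transitivity (\int[plane]_z (g z' * (g z *
      (corr p p z.2 z'.2 * (z'.1 < z.1)%R%:R)))).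
    by apply: eq_Rintegral => z _; rewrite /H/= corrC; ring.
  exact: (RintegralZl _ measurableT (iH' z' _ (mlt2 z'.1))).
have i_before : plane.-integrable setT (EFin \o (fun z' => g z' * before z')).
  have := integrable_Rintegral plane plane _ iH.
  by apply: eq_integrable => // z' _ /=; rewrite HE.
have i_after : plane.-integrable setT (EFin \o (fun z' => g z' * after z')).
  have := integrable_Rintegral2 plane plane _ iH.
  by apply: eq_integrable => // z' _ /=; rewrite HE'.
have swapped : \int[plane]_z' (g z' * before z') =
    \int[plane]_z' (g z' * after z').
  transitivity (\int[plane]_z' \int[plane]_z H (z', z)).
    by apply: eq_Rintegral => z' _; rewrite HE.
  transitivity (\int[plane]_z' \int[plane]_z H (z, z')).
    exact: (RFubini plane plane _ iH).
  by apply: eq_Rintegral => z' _; rewrite HE'.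
have before_after z' : before z' + after z' = \int[plane]_z (g z * corr p p z.2 z'.2).
  transitivity (\int[plane]_z (g z * (corr p p z.2 z'.2 * (z.1 < z'.1)%R%:R) +
      g z * (corr p p z.2 z'.2 * (z'.1 < z.1)%R%:R))).
    exact: (esym (RintegralD measurableT (iH' z' _ (mlt1 z'.1)) (iH' z' _ (mlt2 z'.1)))).
  apply: eq_Rintegral_ae.
  - apply: measurable_funD; apply/measurable_EFinP.
    + exact: measurable_int (iH' z' _ (mlt1 z'.1)).
    + exact: measurable_int (iH' z' _ (mlt2 z'.1)).
  - by apply: measurable_funM; [|exact: mq].
  have := ae_other_time z'.1.
  apply: filterS; first exact: (ae_filter_ringOfSetsType plane).
  move=> z /eqP zz' /=; move: (corr p p z.2 z'.2) (g z) => q gz.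
  have [_|_|/eqP] := ltgtP z.1 z'.1; last by rewrite (negPf zz').
    by rewrite mulr1 !mulr0 addr0.
  by rewrite mulr1 !mulr0 add0r.
have : 0 <= \int[plane]_z' (g z' * before z') + \int[plane]_z' (g z' * after z').
  rewrite [leRHS](_ : _ = \int[plane]_z (g z *
      \int[plane]_z' (g z' * corr p p z'.2 z.2))).
    exact: (corr_positive_definite _ _ _ ig cp ps r0).
  transitivity (\int[plane]_z' (g z' * before z' + g z' * after z')).
    exact: (esym (RintegralD measurableT i_before i_after)).
  by apply: eq_Rintegral => z' _; rewrite -mulrDr before_after.
by rewrite -swapped -mulr2n pmulrn_lge0.
Qed.

(** The mollification of w by the autocorrelation of k. *)
Let A (z : R * R) : R := \int[mu]_x (w (z.1, x) * corr k k x z.2).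

Lemma measurable_smoothed : measurable_fun [set: R * R]
  (fun z => \int[mu]_x (w (z.1, x) * corr k k x z.2)).
Proof.
apply: (measurable_Rintegral mu (fun c : (R * R) * R =>
  w (c.1.1, c.2) * corr k k c.2 c.1.2)).
apply: measurable_funM.
  apply: (measurableT_comp mw).
  by apply: measurable_fun_pair => //; apply: measurableT_comp.
apply: (@measurableT_comp _ _ _ _ _ _ (fun z : R * R => corr k k z.1 z.2) _
  (fun c : (R * R) * R => (c.2, c.1.2))).
  exact: measurable_corr.
by apply: measurable_fun_pair => //; apply: measurableT_comp.
Qed.

Let continuous_corr (f q : R -> R) (x' : R) : smooth f -> supp_in (- r) r f ->
  continuous q -> supp_in (- r) r q -> continuous (corr f q ^~ x').
Proof.
move=> sf fs cq qs; apply: smooth_continuous.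
exact: (smooth_corr _ _ _ _ _ _ x' sf fs cq qs).
Qed.

Lemma smoothed_bounded : exists C, forall z : R * R,
  `|\int[mu]_x (w (z.1, x) * corr k k x z.2)| <= C.
Proof.
have [C C0 kC] := corr_bounded _ ck ks.
exists (M * C * (4 * r)) => z.
rewrite [4 * r](_ : _ = (z.2 + 2 * r) - (z.2 - 2 * r)); last by ring.
apply: Rintegral_le_itv.
- rewrite lerD2l ge0_cp// mulr_ge0// ltW//.
- apply: measurable_funM; first exact: measurable_section.
  by apply: continuous_measurable_fun; exact: continuous_corr.
- by move=> y; rewrite normrM ler_pM.
- by apply: supp_in_mulr; exact: supp_in_corr.
Qed.

Let derive2_corr (x x' : R) :
  'D_1 ('D_1 (corr k k ^~ x')) x = - corr p p x x'.
Proof.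
rewrite (_ : 'D_1 (corr k k ^~ x') = corr p k ^~ x').
  have [_ ->] := derive_corr _ _ _ _ _ _ x x' sp ps ck ks.
  exact: (corr_ibp _ _ _ _ x x' sp sk ks).
by apply/funext => y; have [_ ->] := derive_corr _ _ _ _ _ _ y x' sk ks ck ks.
Qed.

(** The equation tested with the autocorrelation of k centred at x', whose
    second derivative is minus the autocorrelation of k'. *)
Let A_V (x' : R) : {ae mu, forall t, 0 < t < T ->
  A (t, x') = - 2^-1 * V (t, x')}.
Proof.
have sK := smooth_corr _ _ _ _ _ _ x' sk ks ck ks.
have Ks := supp_in_corr _ _ _ x' ks ks.
have := weak_solution_integrated _ _ _ sK Ks.
apply: filterS; first exact: (ae_filter_ringOfSetsType mu).
move=> t At /At; rewrite /A/= => ->.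
have [C C0 pC] := corr_bounded _ cp ps.
have iF : plane.-integrable setT
    (EFin \o (fun z : R * R => g z * (corr p p z.2 x' * (z.1 < t)%R%:R))).
  apply: (integrable_mul_bounded _ _ _ C ig).
    apply: measurable_funM; first exact: (mq (t, x')).
    by apply: measurable_natr_bool; apply: measurable_fun_ltr.
  move=> z; rewrite normrM -[leRHS]mulr1 ler_pM//.
  exact: normr_natr_bool_le1.
have ics (s : R) : mu.-integrable setT (EFin \o (fun x => g (s, x) * corr p p x x')).
  have ic : mu.-integrable setT (EFin \o corr p p ^~ x').
    apply: integrable_supp_in (supp_in_corr _ _ _ x' ps ps).
    exact: continuous_corr.
  have := integrable_mul_bounded _ _ _ _ ic (measurable_section g s mg) (fun x => gM (s, x)).
  by apply: eq_integrable => // x _ /=; rewrite mulrC.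
rewrite /V -(Rintegral_prod1 mu mu _ iF) -RintegralZl//; last first.
  exact: (integrable_Rintegral mu mu _ iF).
apply: eq_Rintegral => s _ /=.
rewrite mulNr -mulrN -mulrA; congr (_ * _).
transitivity (\int[mu]_x (- (s < t)%R%:R * (g (s, x) * corr p p x x'))); last first.
  rewrite -[RHS]mulN1r -[RHS]RintegralZl.
    by apply: eq_Rintegral => x _; ring.
  by [].
  have := integrable_scale (s < t)%R%:R (ics s).
  by apply: eq_integrable => // x _ /=; congr EFin; ring.
rewrite [RHS]RintegralZl// [RHS]mulNr [LHS]mulrC -[RHS]mulrN; congr (_ * _).
rewrite -[RHS]mulN1r -[RHS]RintegralZl//; apply: eq_Rintegral => x _.
by rewrite derive2_corr; ring.
Qed.

(** As the integral of g A is -1/2 times that of g V, V_sum_ge0 applies. The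
    identity between A and V holds for every x' outside a set of times that
    depends on x', hence the integration over t first. *)
Lemma energy_le0 :
  \int[plane]_z (g z * \int[mu]_x (w (z.1, x) * corr k k x z.2)) <= 0.
Proof.
have mA := measurable_smoothed; have [CA AC] := smoothed_bounded; have [CV VC] := V_bounded.
have swap (f : R * R -> R) (C : R) : measurable_fun setT f -> (forall z, `|f z| <= C) ->
    \int[plane]_z (g z * f z) = \int[mu]_x \int[mu]_t (g (t, x) * f (t, x)).
  move=> mf fC; have igf := integrable_mul_bounded _ _ _ _ ig mf fC.
  by rewrite -(RFubini mu mu _ igf) (Rintegral_prod1 mu mu _ igf).
rewrite (_ : \int[plane]_z _ = \int[plane]_z (g z * (- 2^-1 * V z))).
  have := V_sum_ge0.
  rewrite (_ : \int[plane]_z (g z * (- 2^-1 * V z)) = - 2^-1 * \int[plane]_z (g z * V z)).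
    by lra.
  rewrite -RintegralZl//; last exact: (integrable_mul_bounded _ _ _ _ ig mV VC).
  by apply: eq_Rintegral => z _; ring.
have mV2 : measurable_fun [set: R * R] (fun z => - 2^-1 * V z).
  by apply: measurable_funM => //; exact: measurable_cst.
have V2C z : `|- 2^-1 * V z| <= 2^-1 * CV.
  rewrite normrM normrN [X in X * _]ger0_norm ?invr_ge0//.
  by apply: ler_wpM2l => //; rewrite invr_ge0.
transitivity (\int[mu]_x \int[mu]_t (g (t, x) * A (t, x))).
  exact: (swap A CA mA AC).
transitivity (\int[mu]_x \int[mu]_t (g (t, x) * (- 2^-1 * V (t, x)))); last first.
  exact: (esym (swap _ _ mV2 V2C)).
apply: eq_Rintegral => x _; apply: eq_Rintegral_ae.
- by apply: measurable_funM; [exact: (measurable_section2 g)|exact: (measurable_section2 A)].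
- apply: measurable_funM; first exact: (measurable_section2 g).
  exact: (measurable_section2 _ _ mV2).
have ae_ne (t0 : R) : {ae mu, forall t : R, t <> t0}.
  exists [set t0]; split=> //; first exact: lebesgue_measure_set1.
  by move=> t /= /contrapT.
have H := ae_filter_ringOfSetsType mu.
apply: filterS3 (A_V x) (ae_ne 0) (ae_ne T) => t At /eqP t0 /eqP tT.
have [/andP[t1 t2]|/gs->] := boolP (0 <= t <= T); last by rewrite !mul0r.
by rewrite At// !lt_neqAle t1 t2 tT eq_sym t0.
Qed.

End energy_inequality.

(** * Mean oscillation at small scales *)

Section concentration.
Context {R : realType}.
Local Notation mu := (@lebesgue_measure R).
Local Notation plane := (@plane R).
Variables (w g : R * R -> R) (M : R).
Hypotheses (mw : measurable_fun [set: R * R] w) (wM : forall z, `|w z| <= M).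
Hypothesis ig : plane.-integrable [set: R * R] (EFin \o g).

Let mg : measurable_fun [set: R * R] g.
Proof. by apply/measurable_EFinP; exact: measurable_int ig. Qed.

Definition oscillation (rho : R) (z : R * R) : R :=
  \int[mu]_y (`|w (z.1, y) - w z| * (`|y - z.2| < rho)%R%:R).

Let mball (rho : R) : measurable_fun [set: (R * R) * R]
  (fun c : (R * R) * R => (`|c.2 - c.1.2| < rho)%R%:R : R).
Proof.
apply: measurable_natr_bool; apply: measurable_fun_ltr; last exact: measurable_cst.
apply: measurableT_comp => //; apply: measurable_funB => //.
exact: measurableT_comp.
Qed.

Lemma measurable_oscillation rho : measurable_fun [set: R * R] (oscillation rho).
Proof.
apply: (measurable_Rintegral mu (fun c : (R * R) * R =>
  `|w (c.1.1, c.2) - w c.1| * (`|c.2 - c.1.2| < rho)%R%:R)).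
apply: measurable_funM; last exact: mball.
apply: measurableT_comp => //; apply: measurable_funB; last exact: measurableT_comp.
apply: (measurableT_comp mw); apply: measurable_fun_pair => //.
exact: measurableT_comp.
Qed.

Let M0 : 0 <= M. Proof. exact: le_trans (wM (0, 0)). Qed.

Lemma oscillation_bound (rho : R) z : 0 < rho ->
  `|rho^-1 * oscillation rho z| <= 4 * M.
Proof.
move=> rho0; rewrite normrM normfV [`|rho|]gtr0_norm// ler_pdivrMl//.
rewrite [rho * _](_ : _ = 2 * M * ((z.2 + rho) - (z.2 - rho))); last by ring.
apply: Rintegral_le_itv.
- by rewrite lerD2l ge0_cp// ltW.
- apply: measurable_funM; last first.
    apply: (measurableT_comp (mball rho) (g := fun y : R => (z, y))).
    exact: measurable_fun_pair.
  apply: measurableT_comp => //; apply: measurable_funB; last exact: measurable_cst.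
  exact: measurable_section.
- move=> y; rewrite normrM normr_id -[leRHS]mulr1 ler_pM//.
    by rewrite (le_trans (ler_normB _ _))// mulr_natl mulr2n lerD.
  exact: normr_natr_bool_le1.
- move=> y yz; rewrite (_ : _ < _ = false) ?mulr0//; apply/negbTE.
  by apply: contra yz; rewrite ltr_norml => /andP[y1 y2]; apply/andP; split; lra.
Qed.

Lemma integrable_oscillation (rho : R) z : mu.-integrable setT
  (EFin \o (fun y : R => `|w (z.1, y) - w z| * (`|y - z.2| < rho)%R%:R)).
Proof.
rewrite (_ : EFin \o _ =
    (EFin \o (fun y => `|w (z.1, y) - w z|)) \_ (ball z.2 rho)); last first.
  apply/funext => y; rewrite patchE; case: ifPn.
    by rewrite inE -ball_normE/= distrC => ->; rewrite mulr1.
  by rewrite notin_setE -ball_normE/= distrC => /negP/negPf ->; rewrite mulr0.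
apply/(integrable_mkcond _ _).1; first exact: measurable_ball.
apply: integrable_norm; apply: (@integrable_ball_bounded _ _ (M + M)).
  by apply: measurable_funB; [exact: measurable_section|exact: measurable_cst].
by move=> y; rewrite (le_trans (ler_normB _ _))// lerD.
Qed.

(** Lebesgue's differentiation theorem on each time slice. *)
Lemma oscillation_cvg0 (t : R) : {ae mu, forall x,
  rho^-1 * oscillation rho (t, x) @[rho --> 0^'+] --> (0 : R)}.
Proof.
have mwt := measurable_section _ t mw.
have wtM x : `|w (t, x)| <= M by exact: wM.
have := lebesgue_differentiation (bounded_locally_integrable _ _ mwt wtM).
apply: filterS; first exact: (ae_filter_ringOfSetsType mu).
move=> x /(lebesgue_pt_Rintegral _ _ _ mwt wtM); apply: cvg_trans.
apply: near_eq_cvg; near=> rho; congr (_ * _).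
rewrite Rintegral_mkcond; apply: eq_Rintegral => y _.
rewrite patchE; case: ifPn.
  by rewrite inE -ball_normE/= distrC => ->; rewrite mulr1.
by rewrite notin_setE -ball_normE/= distrC => /negP/negPf ->; rewrite mulr0.
Unshelve. all: by end_near. Qed.

Let rho (n : nat) : R := n.+1%:R^-1.
Let rho_gt0 n : 0 < rho n. Proof. by rewrite invr_gt0. Qed.

Let E n z : R := (rho n)^-1 * oscillation (rho n) z.

Let mE n : measurable_fun [set: R * R] (E n).
Proof.
apply: measurable_funM; [exact: measurable_cst|exact: measurable_oscillation].
Qed.

Let E_cvg0 (t : R) : {ae mu, forall x, E n (t, x) @[n --> \oo] --> (0 : R)}.
Proof.
have := oscillation_cvg0 t.
apply: filterS; first exact: (ae_filter_ringOfSetsType mu).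
move=> x /cvg_at_rightP; apply; split => //.
exact: cvg_harmonic.
Qed.

Let iGE n : plane.-integrable [set: R * R] (EFin \o (fun z => `|g z| * E n z)).
Proof.
apply: (integrable_mul_bounded _ _ _ (4 * M) (integrable_norm ig)); first exact: mE.
by move=> z; apply: oscillation_bound.
Qed.

(** Dominated convergence in x on almost every slice, then in t; the integrand
    is at most 4 M |g|. *)
Lemma weighted_oscillation_cvg0 :
  \int[plane]_z (`|g z| * ((n.+1%:R^-1)^-1 * oscillation n.+1%:R^-1 z))
    @[n --> \oo] --> (0 : R).
Proof.
pose F n t : R := \int[mu]_x (`|g (t, x)| * E n (t, x)).
have FE n : \int[plane]_z (`|g z| * E n z) = \int[mu]_t F n t.
  by rewrite -(Rintegral_prod1 mu mu _ (iGE n)).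
under eq_fun do rewrite FE.
have ig4 : plane.-integrable setT (EFin \o (fun z => `|g z| * (4 * M))).
  exact: (integrable_scaler (4 * M) (integrable_norm ig)).
have igt : {ae mu, forall t, mu.-integrable setT (EFin \o (fun x => g (t, x)))}.
  exact: (ae_integrable1 ig).
have F0 : {ae mu, forall t, F n t @[n --> \oo] --> (0 : R)}.
  move: igt; apply: filterS; first exact: (ae_filter_ringOfSetsType mu).
  move=> t igt; apply: (Rintegral_cvg0 mu (fun n x => `|g (t, x)| * E n (t, x))
    (fun x => `|g (t, x)| * (4 * M))).
  - move=> n; apply: measurable_funM; last exact: (measurable_section (E n)).
    by apply: measurableT_comp => //; exact: measurable_section.
  - exact: (integrable_scaler (4 * M) (integrable_norm igt)).
  - apply: aeW => x n; rewrite normrM normr_id ler_wpM2l//; exact: oscillation_bound.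
  - have := E_cvg0 t; apply: filterS; first exact: (ae_filter_ringOfSetsType mu).
    by move=> x Ex; rewrite -(mulr0 `|g (t, x)|); apply: cvgM => //; exact: cvg_cst.
apply: (Rintegral_cvg0 mu F (fun t => \int[mu]_x (`|g (t, x)| * (4 * M)))) => //.
- by move=> n; apply/measurable_EFinP; exact: measurable_int (integrable_Rintegral mu mu _ (iGE n)).
- exact: (integrable_Rintegral mu mu _ ig4).
- move: igt; apply: filterS; first exact: (ae_filter_ringOfSetsType mu).
  move=> t igt n; apply: Rintegral_abs_le.
  + exact: (integrable_scaler (4 * M) (integrable_norm igt)).
  + apply: measurable_funM; last exact: (measurable_section (E n)).
    by apply: measurableT_comp => //; exact: measurable_section.
  + move=> x; rewrite normrM normr_id ler_wpM2l//; exact: oscillation_bound.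
Qed.
End concentration.

(** * Uniqueness for monotone fluxes *)

Section bump_correlation.
Context {R : realType}.
Local Notation mu := (@lebesgue_measure R).
Variables (k : R -> R) (r kappa : R).
Hypotheses (sk : smooth k) (k01 : forall x, 0 <= k x <= 1)
  (ks : supp_in (- r) r k) (r0 : 0 < r) (kappa0 : 0 <= kappa)
  (k_ge : forall x, `|x| <= r / 2 -> kappa <= k x).

Let k0 x : 0 <= k x. Proof. by have /andP[] := k01 x. Qed.
Let k1 x : k x <= 1. Proof. by have /andP[] := k01 x. Qed.
Let ck := smooth_continuous _ sk.

Lemma corr_bump_ge0 x x' : 0 <= corr k k x x'.
Proof. by apply: Rintegral_ge0 => y _; rewrite mulr_ge0. Qed.

Lemma corr_bump_le x x' : corr k k x x' <= 2 * r.
Proof.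
rewrite -(ger0_norm (corr_bump_ge0 x x')).
rewrite (_ : 2 * r = 1 * ((r - x') - (- r - x'))); last by ring.
apply: Rintegral_le_itv.
- by rewrite lerD2r ge0_cp// ltW.
- by apply: continuous_measurable_fun; exact: continuous_corr_integrand.
- by move=> y; rewrite ger0_norm ?mulr_ge0// mulr_ile1.
- by apply: supp_in_mulr; exact: supp_in_translate.
Qed.

Lemma corr_bump_ge x x' : `|x - x'| <= r / 4 ->
  kappa * kappa * (r / 2) <= corr k k x x'.
Proof.
rewrite ler_norml => /andP[x1 x2].
have r0' := r0.
rewrite (_ : r / 2 = (- x' + r / 4) - (- x' - r / 4)); last by field.
apply: Rintegral_ge_itv.
- lra.
- exact: (integrable_corr _ _ _ _ _ _ ck ck ks).
- by move=> y; rewrite mulr_ge0.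
- move=> y /andP[y1 y2]; apply: ler_pM => //; apply: k_ge; rewrite ler_norml;
  by apply/andP; split; lra.
Qed.

Lemma integrable_corr_bump x' : mu.-integrable setT (EFin \o (corr k k ^~ x')).
Proof.
apply: integrable_supp_in (supp_in_corr _ _ _ x' ks ks).
apply: smooth_continuous.
exact: (smooth_corr _ _ _ _ _ _ x' sk ks ck ks).
Qed.

Lemma Rintegral_corr_bump_ge x' :
  kappa * kappa * (r / 2) * (r / 2) <= \int[mu]_x corr k k x x'.
Proof.
have r0' := r0.
rewrite [X in _ * X <= _](_ : r / 2 = (x' + r / 4) - (x' - r / 4)); last by field.
apply: Rintegral_ge_itv.
- lra.
- exact: integrable_corr_bump.
- by move=> y; exact: corr_bump_ge0.
- move=> y /andP[y1 y2]; apply: corr_bump_ge.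
  by rewrite ler_norml; apply/andP; split; lra.
Qed.

End bump_correlation.

Section monotone_flux_uniqueness.
Context {R : realType}.
Local Notation mu := (@lebesgue_measure R).
Local Notation plane := (@plane R).
Variables (w g : R * R -> R) (M T c : R).
Hypotheses (mw : measurable_fun [set: R * R] w) (mg : measurable_fun [set: R * R] g).
Hypotheses (wM : forall z, `|w z| <= M) (gM : forall z, `|g z| <= M).
Hypothesis ig : plane.-integrable [set: R * R] (EFin \o g).
Hypotheses (ws : forall t x, ~~ (0 <= t <= T) -> w (t, x) = 0)
  (gs : forall t x, ~~ (0 <= t <= T) -> g (t, x) = 0).
Hypothesis weak : forall (theta psi : R -> R) (a b c d : R),
  smooth theta -> supp_in a b theta -> b < T -> smooth psi -> supp_in c d psi ->
  \int[mu]_t (\int[mu]_x (w (t, x) * psi x) * 'D_1 theta t) +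
  \int[mu]_t (2^-1 * \int[mu]_x (g (t, x) * 'D_1 ('D_1 psi) x) * theta t) = 0.
Hypotheses (c0 : 0 < c) (monotone : forall z, c * (w z ^+ 2) <= g z * w z).

Let gw_ge0 z : 0 <= g z * w z.
Proof. by rewrite (le_trans _ (monotone z))// mulr_ge0 ?sqr_ge0// ltW. Qed.

Let igw : plane.-integrable setT (EFin \o (fun z => g z * w z)).
Proof. exact: (integrable_mul_bounded _ _ _ _ ig mw wM). Qed.

(** Let A be w mollified by the autocorrelation K of a bump of radius r. At each
    point, w times the mass of K differs from A by at most 2 r times the
    oscillation of w at a scale rho larger than the support of K, and the mass
    of K is at least (kappa r / 2)^2. Since the integral of g A is at most 0, a
    positive integral of g w would be bounded by a null sequence of
    oscillations. *)
Lemma pairing_le0 : \int[plane]_z (g z * w z) <= 0.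
Proof.
have [kappa kappa0 bump] := @bump_exists R.
have cvgE := weighted_oscillation_cvg0 _ _ _ mw wM ig.
rewrite leNgt; apply/negP => gw0.
(* with r = rho / 4, the mass bound (kappa r / 2)^2 and the error factor
   2 r rho = 8 r^2 are in the ratio kappa^2 / 32 *)
have e0 : 0 < kappa * kappa / 32 * \int[plane]_z (g z * w z).
  by rewrite !mulr_gt0.
have [n nE] : exists n : nat, \int[plane]_z (`|g z| *
    ((n.+1%:R^-1)^-1 * oscillation w n.+1%:R^-1 z)) <
    kappa * kappa / 32 * \int[plane]_z (g z * w z).
  have nearE : \forall n \near \oo, \int[plane]_z (`|g z| *
    ((n.+1%:R^-1)^-1 * oscillation w n.+1%:R^-1 z)) <
    kappa * kappa / 32 * \int[plane]_z (g z * w z).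
    exact: (cvgr_lt 0 cvgE).
  by have [n nE] := filter_ex nearE; exists n.
pose rho : R := n.+1%:R^-1; pose r := rho / 4.
have rho0 : 0 < rho by rewrite invr_gt0.
have r0 : 0 < r by rewrite divr_gt0.
have r_rho : 2 * r < rho by rewrite /r; have := rho0; lra.
have [k [sk k01 kr k_ge]] := bump r r0.
have ks : supp_in (- r) r k.
  by move=> x xr; apply: kr; rewrite leNgt; apply: contra xr; rewrite ltr_norml => /andP[x1 x2]; rewrite !ltW.
have ck := smooth_continuous _ sk.
pose A (z : R * R) : R := \int[mu]_x (w (z.1, x) * corr k k x z.2).
have mA : measurable_fun setT A by exact: measurable_smoothed.
have [CA AC] : exists C, forall z, `|A z| <= C := smoothed_bounded _ _ mw wM _ _ sk ks r0.
have gA : \int[plane]_z (g z * A z) <= 0.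
  exact: (energy_le0 _ _ _ _ mw mg wM gM ig ws gs weak _ _ sk ks r0).
have igA := integrable_mul_bounded _ _ _ _ ig mA AC.
have pointwise (z : R * R) : kappa * kappa * (r / 2) * (r / 2) * (g z * w z) <=
    g z * A z + 2 * r * rho * (`|g z| * (rho^-1 * oscillation w rho z)).
  pose K x := corr k k x z.2.
  have iK : mu.-integrable setT (EFin \o K) := integrable_corr_bump _ _ sk ks z.2.
  have mK : measurable_fun setT K by apply/measurable_EFinP; exact: measurable_int iK.
  have iwK : mu.-integrable setT (EFin \o (fun x => w (z.1, x) * K x)).
    have := integrable_mul_bounded _ _ _ _ iK (measurable_section w z.1 mw) (fun x => wM (z.1, x)).
    by apply: eq_integrable => // x _ /=; rewrite mulrC.
  have iwzK := integrable_scale (w z) iK.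
  pose D := \int[mu]_x ((w (z.1, x) - w z) * K x).
  have DE : w z * \int[mu]_x K x = A z - D.
    suff -> : D = A z - w z * \int[mu]_x K x by ring.
    rewrite -RintegralZl// -RintegralB//.
    by apply: eq_Rintegral => x _; rewrite mulrBl.
  have Dle : `|D| <= 2 * r * oscillation w rho z.
    have iO := integrable_oscillation _ _ mw wM rho z.
    rewrite /oscillation -RintegralZl//; apply: Rintegral_abs_le.
    - exact: (integrable_scale (2 * r) iO).
    - apply: measurable_funM => //; apply: measurable_funB; last exact: measurable_cst.
      exact: measurable_section.
    - move=> x; rewrite normrM mulrCA; apply: ler_wpM2l => //.
      have [xz|xz] := ltP `|x - z.2| rho.
        rewrite mulr1 ger0_norm; first exact: (corr_bump_le _ _ sk k01 ks r0).
        exact: corr_bump_ge0.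
      rewrite mulr0 /K (supp_in_corr _ _ _ _ ks ks) ?normr0//.
      apply: contraL xz => /andP[x1 x2]; rewrite -ltNge ltr_distl.
      by rewrite (lt_le_trans _ x1) ?(le_lt_trans x2)// ltrD2l ?ltrN2.
  have cK := Rintegral_corr_bump_ge _ _ _ sk k01 ks r0 (ltW kappa0) k_ge z.2.
  rewrite (@le_trans _ _ (\int[mu]_x K x * (g z * w z)))//; first exact: ler_wpM2r.
  rewrite mulrCA [_ * w z]mulrC DE mulrBr lerD2l.
  rewrite -mulrN; apply: le_trans (ler_norm _) _; rewrite normrM normrN.
  rewrite [leRHS](_ : _ = `|g z| * (2 * r * oscillation w rho z)); last first.
    by field; rewrite gt_eqF.
  exact: ler_wpM2l.
have igO : plane.-integrable setT (EFin \o (fun z => `|g z| * (rho^-1 * oscillation w rho z))).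
  apply: (integrable_mul_bounded _ _ _ (4 * M) (integrable_norm ig)).
    by apply: measurable_funM; [exact: measurable_cst|exact: measurable_oscillation].
  by move=> z; apply: oscillation_bound.
have igO2 : plane.-integrable setT (EFin \o
    (fun z => 2 * r * rho * (`|g z| * (rho^-1 * oscillation w rho z)))).
  exact: (integrable_scale (2 * r * rho) igO).
have : \int[plane]_z (kappa * kappa * (r / 2) * (r / 2) * (g z * w z)) <=
   \int[plane]_z (g z * A z + 2 * r * rho * (`|g z| * (rho^-1 * oscillation w rho z))).
  apply: le_Rintegral => //.
  - exact: (integrable_scale (kappa * kappa * (r / 2) * (r / 2)) igw).
  - by have := integrableD measurableT igA igO2; apply: eq_integrable.
rewrite RintegralZl// RintegralD// RintegralZl//.
move: nE gw0 gA; rewrite -/rho.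
set O := \int[plane]_z _; set G := \int[plane]_z _; set AA := \int[plane]_z _.
move=> GO G0 A0 H.
have r2 : 0 < r * r by rewrite mulr_gt0.
have : kappa * kappa * (r / 2) * (r / 2) * G <= 2 * r * rho * O.
  by apply: le_trans H _; rewrite gerDr.
have -> : kappa * kappa * (r / 2) * (r / 2) * G = (r * r) * (8 * (kappa * kappa / 32 * G)) by field.
have -> : 2 * r * rho * O = (r * r) * (8 * O) by rewrite /r; field.
by rewrite ler_pM2l// ler_pM2l// leNgt GO.
Qed.

(** Strong monotonicity turns pairing_le0 into a bound by 0 for the integral of
    w^2 over the plane. *)
Lemma monotone_flux_unique : {ae mu, forall t, {ae mu, forall x, w (t, x) = 0}}.
Proof.
have iw2 : plane.-integrable setT (EFin \o (fun z => w z ^+ 2)).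
  apply: (integrable_le plane (fun z => w z ^+ 2) (fun z => c^-1 * (g z * w z))).
  - exact: measurable_funX.
  - exact: (integrable_scale c^-1 igw).
  - by move=> z; rewrite ger0_norm ?sqr_ge0// ler_pdivlMl.
have w20 : \int[plane]_z (w z ^+ 2) = 0.
  apply/eqP; rewrite eq_le; apply/andP; split; last first.
    by apply: Rintegral_ge0 => z _; exact: sqr_ge0.
  rewrite -(pmulr_rle0 _ c0); apply: le_trans pairing_le0.
  rewrite -RintegralZl//; apply: le_Rintegral => //.
  exact: (integrable_scale c iw2).
have iw2t := integrable_Rintegral mu mu _ iw2.
have : \int[mu]_t \int[mu]_x (w (t, x) ^+ 2) = 0.
  by rewrite (Rintegral_prod1 mu mu _ iw2).
have ae0 (f : R -> R) : mu.-integrable setT (EFin \o f) -> (forall t, 0 <= f t) ->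
    \int[mu]_t f t = 0 -> {ae mu, forall t, f t = 0}.
  move=> itf f0 if0.
  have mf := measurable_int _ itf.
  have : (\int[mu]_t `|(EFin \o f) t| = 0)%E.
    transitivity (\int[mu]_t (f t)%:E)%E.
      by apply: eq_integral => t _ /=; rewrite ger0_norm.
    by rewrite (Rintegral_EFin _ _ itf) if0.
  move=> /(ae_eq_integral_abs _ measurableT mf) H.
  have FF := ae_filter_ringOfSetsType mu.
  by apply: filterS H => t /(_ I) /= [].
move=> /(ae0 _ iw2t (fun t => Rintegral_ge0 _ _)) => H.
have H2 := ae_integrable1 iw2.
have FF := ae_filter_ringOfSetsType mu.
have {}H := H (fun t x _ => sqr_ge0 _).
apply: filterS2 H H2 => t t0 it.
have := ae0 _ it (fun x => sqr_ge0 _) t0.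
apply: filterS => x /eqP; rewrite sqrf_eq0 => /eqP //.
Qed.

End monotone_flux_uniqueness.

(** * Measurability and bounds for the inverse of h *)

Section measurability.
Context {R : realType}.

Lemma measurable_upper_levels {d} {T : measurableType d} (f : T -> R) :
  (forall a, measurable [set z | a < f z]) -> measurable_fun setT f.
Proof.
move=> mf mD; apply: (measurability _ (RGenOInfty.measurableE R)) => //.
move=> _ [_ [a ->] <-]; rewrite setTI.
rewrite (_ : _ @^-1` _ = [set z | a < f z]); first exact: mf.
by apply/seteqP; split => z /=; rewrite in_itv/= andbT.
Qed.

(** A Lipschitz function is the supremum of countably many cones with
    rational vertices. *)
Lemma measurable_lipschitz (f : R * R -> R) (L : R) : 0 <= L ->
  (forall z z', `|f z - f z'| <= L * (`|z.1 - z'.1| + `|z.2 - z'.2|)) ->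
  measurable_fun [set: R * R] f.
Proof.
move=> L0 fL; apply: measurable_upper_levels => a.
pose cone (p q : rat) : set (R * R) := [set z | a < f (ratr p, ratr q) -
  L * (`|z.1 - ratr p| + `|z.2 - ratr q|)].
rewrite (_ : [set z | a < f z] = \bigcup_(p : rat) \bigcup_(q : rat) cone p q).
  apply: bigcupT_measurable_rat => p; apply: bigcupT_measurable_rat => q.
  have mG : measurable_fun [set: R * R] (fun z : R * R => a < f (ratr p, ratr q) -
      L * (`|z.1 - ratr p| + `|z.2 - ratr q|)).
    apply: measurable_fun_ltr; first exact: measurable_cst.
    apply: measurable_funB; first exact: measurable_cst.
    apply: measurable_funM; first exact: measurable_cst.
    apply: measurable_funD; apply: measurableT_comp => //;
    apply: measurable_funB => //; exact: measurable_cst.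
  have := mG measurableT [set true] (I : measurable [set true]).
  rewrite setTI; congr measurable; apply/seteqP; split=> z; rewrite /cone/=; by move=> ->.
apply/seteqP; split=> z /=; last first.
  move=> [p _ [q _]]; rewrite /cone/= => /lt_le_trans; apply.
  rewrite lerBlDr addrC -lerBlDr (le_trans (ler_norm _))//.
  by rewrite (le_trans (fL _ _))//= distrC [`|ratr q - _|]distrC.
move=> az; pose e := (f z - a) / (4 * (L + 1)).
have L1 : 0 < L + 1 by lra.
have e0 : 0 < e by rewrite divr_gt0 ?subr_gt0// mulr_gt0.
have rat_near (x : R) : exists q : rat, `|x - ratr q| < e.
  have [y [xy [q _ qE]]] : (ball x e `&` range (@ratr R)) !=set0.
    by apply: dense_rat; [exists x; exact: ballxx|exact: ball_open].
  by exists q; rewrite qE; move: xy; rewrite -ball_normE.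
have [p zp] := rat_near z.1; have [q zq] := rat_near z.2.
exists p => //; exists q => //; rewrite /cone/=.
have H1 := fL z (ratr p, ratr q); rewrite /= in H1.
have H2 := le_trans (ler_norm _) H1.
have H3 : L * (`|z.1 - ratr p| + `|z.2 - ratr q|) <= L * (e + e).
  by apply: ler_wpM2l => //; apply: lerD; exact: ltW.
have H4 : (L + 1) * (4 * e) = f z - a.
  by rewrite /e; field; rewrite gt_eqF.
lra.
Qed.

End measurability.

Section inverse.
Context {R : realType} (T : R) (h : R -> R -> R -> R) (ch c0 C0 : R).
Hypothesis hc : h_conditions T h ch c0 C0.
Hypothesis T0 : 0 < T.

Let hmono t x : 0 <= t <= T -> {mono h t x : y z / y < z}.
Proof. by move=> tT; apply: leW_mono; apply: le_mono; exact: h_increasing hc _ _ tT. Qed.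

Lemma h_invK t x v : 0 <= t <= T -> h t x (h_inv h t x v) = v.
Proof.
move=> tT; have [hy hNy] := h_limits hc x tT.
have [b hb] : exists b, v < h t x b.
  have : \forall z \near +oo, v < h t x z by move/cvgryPgt : hy; exact.
  by move=> /filter_ex.
have [a ha] : exists a, h t x a < v.
  have : \forall z \near -oo, h t x z < v by move/cvgrNyPlt : hNy; exact.
  by move=> /filter_ex.
have ab : a < b by rewrite -(hmono _ x tT) (lt_trans ha).
have chtx : {within `[a, b], continuous (h t x)}.
  by apply: continuous_within_itv; exact: h_continuous hc _ _ tT.
have [|z _ hz] := IVT (ltW ab) chtx (v := v).
  by rewrite ge_min le_max (ltW ha) (ltW hb) orbT.
have ex : exists z, [set z | h t x z = v] z by exists z.
exact: (xgetPex 0 ex).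
Qed.

(** Superlevel sets of the inverse are described by h itself; monotonicity and
    measurability both follow from this. *)
Lemma h_inv_gt t x v z : 0 <= t <= T -> (z < h_inv h t x v) = (h t x z < v).
Proof. by move=> tT; rewrite -(hmono _ x tT) h_invK. Qed.

Lemma h_inv_le t x v v' : 0 <= t <= T -> v <= v' ->
  h_inv h t x v <= h_inv h t x v'.
Proof. by move=> tT vv'; rewrite leNgt h_inv_gt// h_invK// -leNgt. Qed.

Lemma h_inv_ge t x v : 0 <= t <= T -> 0 <= v -> c0 <= h_inv h t x v.
Proof.
move=> tT v0; have /andP[+ _] := h_inv0_bounds hc x tT.
by move=> /le_trans; apply; exact: h_inv_le.
Qed.

(** The mean value theorem between the inverses of 0 and v, where the slope of
    h is at least ch. *)
Lemma h_inv_le_affine t x v : 0 <= t <= T -> 0 <= v ->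
  h_inv h t x v <= C0 + v / ch.
Proof.
move=> tT v0; have /andP[_ zC] := h_inv0_bounds hc x tT.
have ch0 := h_ch_gt0 hc.
set z0 := h_inv h t x 0 in zC *; set z := h_inv h t x v.
have [zz0|z0z] := leP z z0.
  by rewrite (le_trans zz0)// (le_trans zC)// lerDl divr_ge0// ltW.
have D y : y \in `]z0, z[%R -> is_derive y (1 : R) (h t x) (derive1 (h t x) y).
  move=> _; rewrite derive1E; apply: DeriveDef => //.
  exact: (h_has_partial1 hc Cz x y tT).
have chtx : {within `[z0, z], continuous (h t x)}.
  by apply: continuous_within_itv; exact: h_continuous hc _ _ tT.
have [y _] := MVT z0z D chtx.
rewrite h_invK// h_invK// subr0 => vE.
have := h_dz_lower_bound hc x y tT; rewrite /= => chy.
rewrite -lerBlDl in zC *.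
suff : z - z0 <= v / ch by lra.
rewrite ler_pdivlMr// vE mulrC ler_wpM2r// subr_ge0 ltW//.
Qed.

(** The superlevel set at a is {h(t, x, a) < f}, so that measurability of
    (t, x) |-> h(t, x, a) is what matters; that function is Lipschitz once the
    time is retracted onto [0, T]. *)
Lemma measurable_h_inv (f : R * R -> R) : measurable_fun [set: R * R] f ->
  measurable_fun [set: R * R]
    (fun z => if 0 <= z.1 <= T then h_inv h z.1 z.2 (f z) else 0).
Proof.
move=> mf; apply: measurable_upper_levels => a.
pose tau (t : R) := Num.max 0 (Num.min T t).
have tauT t : 0 <= tau t <= T.
  by rewrite /tau le_max lexx/= ge_max (ltW T0) ge_min lexx.
have tauE t : 0 <= t <= T -> tau t = t.
  by move=> /andP[t1 t2]; rewrite /tau min_r// max_r.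
have minL (s t : R) : `|Num.min T s - Num.min T t| <= `|s - t|.
  have := ler_norm (s - t); have := ler_norm (t - s).
  rewrite [`|t - s|]distrC ler_norml.
  by case: (leP T s) => ?; case: (leP T t) => ? ? ?; apply/andP; split; lra.
have maxL (s t : R) : `|Num.max 0 s - Num.max 0 t| <= `|s - t|.
  have := ler_norm (s - t); have := ler_norm (t - s).
  rewrite [`|t - s|]distrC ler_norml.
  by case: (leP (0 : R) s) => ?; case: (leP (0 : R) t) => ? ? ?; apply/andP; split; lra.
have tauL s t : `|tau s - tau t| <= `|s - t| by exact: le_trans (maxL _ _) (minL _ _).
have [L L0 hL] : exists2 L, 0 <= L & forall z z' : R * R,
   `|h (tau z.1) z.2 a - h (tau z'.1) z'.2 a| <= L * (`|z.1 - z'.1| + `|z.2 - z'.2|).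
  have /pinfty_ex_gt0[L L0 hL] := h_lipschitz hc.
  exists L; first exact: ltW.
  move=> z z'.
  have := hL ((tau z.1, z.2, a), (tau z'.1, z'.2, a)) (conj (tauT z.1) (tauT z'.1)).
  rewrite /= => /le_trans; apply; apply: ler_wpM2l; first exact: ltW.
  rewrite !prod_normE/= !ge_max subrr normr0 addr_ge0// andbT lerDr normr_ge0 andbT.
  by rewrite (le_trans (tauL _ _))// lerDl.
have mh := measurable_lipschitz _ _ L0 hL.
pose S (z : R * R) : bool := 0 <= z.1 <= T.
have mS : measurable_fun [set: R * R] S.
  by apply: measurable_and; apply: measurable_fun_ler => //; exact: measurable_cst.
have mG : measurable_fun [set: R * R]
    (fun z => if S z then h (tau z.1) z.2 a < f z else a < 0).
  apply: measurable_fun_ifT => //; first exact: measurable_fun_ltr.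
have := mG measurableT [set true] (I : measurable [set true]).
rewrite setTI; congr measurable; apply/seteqP; split=> z /=; rewrite /S;
  case: ifPn => // zT; by rewrite tauE// h_inv_gt//; move=> ->.
Qed.

End inverse.

(** * Bounded representatives of solutions *)

Section representative.
Context {R : realType}.
Local Notation mu := (@lebesgue_measure R).
Local Notation plane := (@plane R).
Variables (T : R) (u : R -> R -> R).
Hypothesis T0 : 0 < T.
Hypothesis u_class : solution_class T u.
Hypothesis u_density : {ae mu, forall t, 0 <= t <= T -> probability_density (u t)}.

(** The Sobolev part of the norm is nonnegative, so the essential supremum over
    time of the full norm bounds the L^oo norms in space. *)
Lemma solution_class_bounded : exists2 M, 0 <= M &
  {ae mu, forall t, 0 <= t <= T -> {ae mu, forall x, `|u t x| <= M}}.
Proof.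
have [[_ _ uoo] _] := u_class.
move: uoo; rewrite unlock /Lnorm.
have muT : (0 < mu [set: R])%E.
  by rewrite -set_itvNyy lebesgue_measure_itv/= ltry.
rewrite muT; set f := (X in ess_sup mu X).
move=> fy; have f_ge := ess_sup_ge mu f.
have s0 : (0 <= ess_sup mu f)%E.
  by apply: ess_sup_gee => //; apply: aeW => t; rewrite /f/=.
exists (fine (ess_sup mu f)); first exact: fine_ge0.
have sE : ess_sup mu f = (fine (ess_sup mu f))%:E by rewrite fineK// ge0_fin_numE.
rewrite sE in f_ge; move: (fine _) f_ge => M f_ge.
have FF := ae_filter_ringOfSetsType mu.
apply: filterS f_ge => t; rewrite /f/= => ft tT.
move: ft; rewrite patchE mem_set; last by rewrite /= in_itv.
move=> /(le_trans (lee_abs _)).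
have H0 : (0 <= Hnorm 1 (u t))%E by exact: poweR_ge0.
rewrite /H1_Linfty_norm => uM.
have {uM} : ('N[mu]_+oo [EFin \o u t] <= M%:E)%E.
  by apply: le_trans uM; rewrite leeDr.
rewrite unlock /Lnorm muT => /ess_supP.
by apply: filterS => x /=; rewrite lee_fin.
Qed.

Definition on_strip (f : R -> R -> R) (z : R * R) : R :=
  if 0 <= z.1 <= T then f z.1 z.2 else 0.

Lemma measurable_on_strip : measurable_fun [set: R * R] (on_strip u).
Proof.
have [[mu_u _ _] _] := u_class.
have := (measurable_restrictT _ _).1 mu_u.
have mD : measurable (`[0, T]%classic `*` [set: R] : set (R * R)) by exact: measurableX.
move=> /(_ mD); apply: eq_measurable_fun => z _; rewrite patchE /on_strip.
by case: ifPn => [|/negP]; rewrite inE/= in_itv/=; [move=> [-> _]|case: ifP => // zT []].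
Qed.

Lemma strip_measurable_cond : measurable_fun [set: R * R] (fun z : R * R => 0 <= z.1 <= T).
Proof.
by apply: measurable_and; apply: measurable_fun_ler => //; exact: measurable_cst.
Qed.

(** Truncating to [0, M] changes u only on null sets, as almost every slice is
    a density bounded by M, and turns the almost everywhere bounds into
    pointwise ones. Integrability over the plane comes from each slice having mass 1. *)
Lemma clipped_representative : exists (v : R * R -> R) (M : R),
  [/\ measurable_fun [set: R * R] v,
      forall z, 0 <= v z <= M,
      forall t x, ~~ (0 <= t <= T) -> v (t, x) = 0,
      plane.-integrable [set: R * R] (EFin \o v) &
      {ae mu, forall t, 0 <= t <= T -> {ae mu, forall x, u t x = v (t, x)}}].
Proof.
have [M M0 uM] := solution_class_bounded.
pose v z := if 0 <= z.1 <= T then Num.max 0 (Num.min M (on_strip u z)) else 0.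
have mv : measurable_fun setT v.
  apply: measurable_fun_ifT => //; first exact: strip_measurable_cond.
  apply: measurable_maxr => //; apply: measurable_minr => //.
  exact: measurable_on_strip.
have v0M z : 0 <= v z <= M.
  rewrite /v; case: ifP => _; last by rewrite lexx.
  by rewrite le_max lexx/= ge_max M0 ge_min lexx.
have vs t x : ~~ (0 <= t <= T) -> v (t, x) = 0 by rewrite /v/= => /negPf ->.
have FF := ae_filter_ringOfSetsType mu.
have uv : {ae mu, forall t, 0 <= t <= T -> {ae mu, forall x, u t x = v (t, x)}}.
  apply: filterS2 uM u_density => t uMt ut tT.
  have [_ u0 _] := ut tT.
  apply: filterS2 (uMt tT) u0 => x ux ux0.
  rewrite /v/= tT /on_strip/= tT min_r; last by rewrite (le_trans (ler_norm _)).
  by rewrite max_r.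
exists v, M; split => //.
apply/integrable12ltyP; first exact/measurable_EFinP.
apply: (@le_lt_trans _ _ (\int[mu]_t (\1_(`[0, T]%classic) t)%:E)%E); last first.
  rewrite integral_indic// setIT/= lebesgue_measure_itv/= lte_fin T0.
  by rewrite -EFinB ltry.
have mv1 : measurable_fun setT (fun t => \int[mu]_x `|(EFin \o v) (t, x)|)%E.
  apply: (@measurable_fun_fubini_tonelli_F _ _ _ _ _ mu (fun z => `|(EFin \o v) z|)%E) => //=.
  by apply/measurable_EFinP; exact: measurableT_comp.
rewrite le_eqVlt; apply/orP; left; apply/eqP.
apply: ae_eq_integral => //.
  by apply/measurable_EFinP; exact: measurable_indic.
apply: filterS2 uv u_density => t uvt ut _.
have [tT|tT] := boolP (0 <= t <= T); last first.
  rewrite indicE memNset; last by rewrite /= in_itv/=; exact/negP.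
  rewrite (eq_integral (cst 0%E)) ?integral0// => x _ /=.
  by rewrite vs// normr0.
rewrite indicE mem_set; last by rewrite /= in_itv/=.
have [mut u0 u1] := ut tT; rewrite /= -u1.
apply: ae_eq_integral => //.
- apply/measurable_EFinP; apply: measurableT_comp => //.
  by apply: (measurableT_comp mv); exact: measurable_fun_pair.
- exact/measurable_EFinP.
- by apply: filterS (uvt tT) => x -> _ /=; rewrite ger0_norm//; have /andP[] := v0M (t, x).
Qed.

(** Iterated integrals over the strip are insensitive to null sets of times
    and, for each remaining time, null sets of positions. *)
Lemma Rintegral_strip_ae (P : R -> R -> R) (Q : R * R -> R) :
  measurable_fun [set: R * R] (on_strip P) -> measurable_fun [set: R * R] Q ->
  (forall t x, ~~ (0 <= t <= T) -> Q (t, x) = 0) ->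
  {ae mu, forall t, 0 <= t <= T -> {ae mu, forall x, P t x = Q (t, x)}} ->
  \int[mu]_(t in `[0, T]) \int[mu]_x P t x = \int[mu]_t \int[mu]_x Q (t, x).
Proof.
move=> mP mQ Qs PQ; rewrite Rintegral_mkcond.
transitivity (\int[mu]_t \int[mu]_x on_strip P (t, x)).
  apply: eq_Rintegral => t _; rewrite patchE /on_strip/=; case: ifPn.
    by rewrite inE/= in_itv/= => ->.
  rewrite notin_setE/= in_itv/= => /negP/negPf tT.
  by rewrite tT Rintegral_cst// mul0r.
apply: eq_Rintegral_ae.
- exact: (measurable_Rintegral mu).
- exact: (measurable_Rintegral mu).
have FF := ae_filter_ringOfSetsType mu.
apply: filterS PQ => t PQt.
have [tT|tT] := boolP (0 <= t <= T); last first.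
  by apply: eq_Rintegral => x _; rewrite Qs// /on_strip/= (negPf tT).
apply: eq_Rintegral_ae.
- by apply: (measurableT_comp mP); exact: measurable_fun_pair.
- by apply: (measurableT_comp mQ); exact: measurable_fun_pair.
- by apply: filterS (PQt tT) => x; rewrite /on_strip/= tT.
Qed.

End representative.

(** * The flux and the tested equation *)

Section tested.
Context {R : realType}.
Local Notation mu := (@lebesgue_measure R).
Local Notation plane := (@plane R).

Lemma integrable_tested (F : R * R -> R) (f g : R -> R) (Cf Cg : R) :
  plane.-integrable [set: R * R] (EFin \o F) ->
  (forall t, mu.-integrable [set: R] (EFin \o (fun x => F (t, x) * f x))) ->
  measurable_fun setT f -> (forall x, `|f x| <= Cf) ->
  measurable_fun setT g -> (forall x, `|g x| <= Cg) ->
  mu.-integrable [set: R] (EFin \o (fun t => \int[mu]_x (F (t, x) * f x) * g t)).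
Proof.
move=> iF iFf mf fC mg gC.
have iFfg : plane.-integrable setT (EFin \o (fun z : R * R => F z * (f z.2 * g z.1))).
  apply: (integrable_mul_bounded _ _ _ (Cf * Cg) iF).
    by apply: measurable_funM; apply: measurableT_comp.
  by move=> z; rewrite normrM ler_pM.
have := integrable_Rintegral mu mu _ iFfg.
apply: eq_integrable => // t _ /=; congr EFin.
by rewrite -RintegralZr//; apply: eq_Rintegral => x _; rewrite mulrA.
Qed.

End tested.

Section flux.
Context {R : realType}.
Local Notation mu := (@lebesgue_measure R).
Local Notation plane := (@plane R).
Variables (T : R) (h : R -> R -> R -> R) (ch c0 C0 : R).
Hypothesis hc : h_conditions T h ch c0 C0.
Hypothesis T0 : 0 < T.

(** Outside the strip, where h is arbitrary, the inverse is replaced by 0 to keep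
    the flux measurable on the whole plane. *)
Definition flux (f : R * R -> R) (z : R * R) : R :=
  (if 0 <= z.1 <= T then h_inv h z.1 z.2 (f z) else 0) ^+ 2 * f z.

Lemma measurable_flux f : measurable_fun [set: R * R] f ->
  measurable_fun [set: R * R] (flux f).
Proof.
move=> mf; apply: measurable_funM => //; apply: measurable_funX.
exact: (measurable_h_inv _ _ _ _ _ hc T0).
Qed.

Lemma flux_le (f : R * R -> R) (M : R) z : 0 <= f z <= M ->
  `|flux f z| <= (C0 + M / ch) ^+ 2 * f z.
Proof.
move=> /andP[f0 fM]; have ch0 := h_ch_gt0 hc.
rewrite /flux normrM (ger0_norm f0); apply: ler_wpM2r => //.
case: ifP => [zT|_]; last by rewrite expr0n/= normr0 sqr_ge0.
have H1 := h_inv_ge _ _ _ _ _ hc z.1 z.2 (f z) zT f0.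
have H2 := h_inv_le_affine _ _ _ _ _ hc z.1 z.2 (f z) zT f0.
have H0 : 0 <= h_inv h z.1 z.2 (f z) by apply: le_trans H1; exact/ltW/(h_c0_gt0 hc).
rewrite ger0_norm ?sqr_ge0// ler_pXn2r ?nnegrE//.
  by rewrite (le_trans H2)// lerD2l ler_pM2r ?invr_gt0.
rewrite (le_trans H0)// (le_trans H2)// lerD2l ler_pM2r ?invr_gt0//.
Qed.

Lemma flux_integrable (f : R * R -> R) (M : R) : measurable_fun [set: R * R] f ->
  (forall z, 0 <= f z <= M) -> plane.-integrable [set: R * R] (EFin \o f) ->
  plane.-integrable [set: R * R] (EFin \o flux f).
Proof.
move=> mf f0M itf; apply: (integrable_le plane _ (fun z => (C0 + M / ch) ^+ 2 * f z)).
- exact: measurable_flux.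
- exact: (integrable_scale ((C0 + M / ch) ^+ 2) itf).
- by move=> z; exact: flux_le.
Qed.

(** The flux is strongly monotone because it is the product of the
    nondecreasing function v |-> h_inv v ^ 2, bounded below by c0 ^ 2 on
    nonnegative densities, and of the density itself. *)
Lemma flux_monotone (f g : R * R -> R) z : 0 <= z.1 <= T -> 0 <= f z -> 0 <= g z ->
  c0 ^+ 2 * (f z - g z) ^+ 2 <= (flux f z - flux g z) * (f z - g z).
Proof.
move=> zT; rewrite /flux zT.
have cc := h_c0_gt0 hc.
have key a b : 0 <= b -> b <= a ->
    c0 ^+ 2 * (a - b) ^+ 2 <=
    (h_inv h z.1 z.2 a ^+ 2 * a - h_inv h z.1 z.2 b ^+ 2 * b) * (a - b).
  move=> b0 ba; have a0 := le_trans b0 ba.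
  have Hb := h_inv_ge _ _ _ _ _ hc z.1 z.2 b zT b0.
  have Hab := h_inv_le _ _ _ _ _ hc z.1 z.2 b a zT ba.
  rewrite [(a - b) ^+ 2]expr2 mulrA; apply: ler_wpM2r; first by rewrite subr_ge0.
  have Hb0 := le_trans (ltW cc) Hb.
  apply: (@le_trans _ _ (h_inv h z.1 z.2 b ^+ 2 * (a - b))).
    apply: ler_wpM2r; first by rewrite subr_ge0.
    by rewrite ler_pXn2r ?nnegrE// ltW.
  rewrite mulrBr lerD2r; apply: ler_wpM2r => //.
  by rewrite ler_pXn2r ?nnegrE// (le_trans Hb0).
move: (f z) (g z) => a b a0 b0.
have [ab|ba] := leP a b; last exact: key (ltW ba).
rewrite -(opprB b a) sqrrN mulrN -mulNr opprB; exact: key.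
Qed.

Section weak_form.
Variables (u0 : R -> R) (u : R -> R -> R) (v : R * R -> R) (M : R).
Hypothesis u_class : solution_class T u.
Hypothesis u_solution : weak_solution T h u0 u.
Hypothesis iv : plane.-integrable [set: R * R] (EFin \o v).
Hypotheses (mv : measurable_fun [set: R * R] v) (v0M : forall z, 0 <= v z <= M)
  (vs : forall t x, ~~ (0 <= t <= T) -> v (t, x) = 0)
  (uv : {ae mu, forall t, 0 <= t <= T -> {ae mu, forall x, u t x = v (t, x)}}).

(** The weak formulation for theta(t) psi(x), rewritten for the clipped
    representative as an evolution equation in t alone. The right-hand side
    depends on the initial density only and cancels in the difference of two
    solutions. *)
Lemma weak_solution_tensor (theta psi : R -> R) (a b c d : R) :
  smooth theta -> supp_in a b theta -> b < T -> smooth psi -> supp_in c d psi ->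
  \int[mu]_t (\int[mu]_x (v (t, x) * psi x) * 'D_1 theta t) +
  \int[mu]_t (2^-1 * \int[mu]_x (flux v (t, x) * 'D_1 ('D_1 psi) x) * theta t) =
  - \int[mu]_x (u0 x * (theta 0 * psi x)).
Proof.
move=> st ts bT sp ps.
have := u_solution _ (test_function_tensor _ _ T _ _ _ _ st sp ts ps bT).
have mtheta := measurable_fun_smooth _ st.
have sDt : smooth ('D_1 theta : R -> R) by exact: smooth_derive.
have mDt := measurable_fun_smooth _ sDt.
have mpsi := measurable_fun_smooth _ sp.
have sDDp : smooth ('D_1 ('D_1 psi) : R -> R) by do 2 apply: smooth_derive.
have mDDp := measurable_fun_smooth _ sDDp.
have ip : mu.-integrable setT (EFin \o psi).
  by apply: integrable_supp_in ps; exact: smooth_continuous.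
have iDDp : mu.-integrable setT (EFin \o ('D_1 ('D_1 psi) : R -> R)).
  apply: integrable_supp_in (supp_in_derive _ _ _ (supp_in_derive _ _ _ ps)).
  exact: smooth_continuous.
have mu_u := measurable_on_strip _ _ u_class.
have mfl := measurable_flux _ mv.
have FF := ae_filter_ringOfSetsType mu.
have m2 (f : R -> R) : measurable_fun setT f ->
    measurable_fun [set: R * R] (fun z : R * R => f z.2).
  by move=> mf; exact: measurableT_comp.
have m1 (f : R -> R) : measurable_fun setT f ->
    measurable_fun [set: R * R] (fun z : R * R => f z.1).
  by move=> mf; exact: measurableT_comp.
have vM z : `|v z| <= M by have /andP[v0 v1] := v0M z; rewrite ger0_norm.
have flC z : `|flux v z| <= (C0 + M / ch) ^+ 2 * M.
  rewrite (le_trans (flux_le _ _ _ (v0M z)))//.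
  by apply: ler_wpM2l; [exact: sqr_ge0|have /andP[] := v0M z].
have imul (f : R -> R) (F : R * R -> R) (C t : R) :
    mu.-integrable setT (EFin \o f) -> measurable_fun [set: R * R] F ->
    (forall z, `|F z| <= C) ->
    mu.-integrable setT (EFin \o (fun x => F (t, x) * f x)).
  move=> jf mF FC.
  have := integrable_mul_bounded _ _ _ _ jf (measurable_section _ t mF) (fun x => FC (t, x)).
  by apply: eq_integrable => // x _ /=; rewrite mulrC.
have -> : \int[mu]_(t in `[0, T]) \int[mu]_x
    (u t x * 'D_((1 : R), (0 : R)) (tensor theta psi) (t, x)) =
    \int[mu]_t (\int[mu]_x (v (t, x) * psi x) * 'D_1 theta t).
  rewrite (@Rintegral_strip_ae _ T (fun t x => u t x * 'D_((1 : R), (0 : R)) (tensor theta psi) (t, x))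
    (fun z => v z * (psi z.2 * 'D_1 theta z.1))).
  - apply: eq_Rintegral => t _.
    rewrite -RintegralZr//.
      by apply: eq_Rintegral => x _; rewrite mulrA.
    exact: imul ip mv vM.
  - rewrite (_ : on_strip T _ =
      (fun z => on_strip T u z * (psi z.2 * 'D_1 theta z.1))).
      by apply: measurable_funM => //; apply: measurable_funM; [exact: m2|exact: (m1 _ mDt)].
    apply/funext => z; rewrite /on_strip; case: ifP => _; last by rewrite mul0r.
    by rewrite derive_tensor_fst//= [psi _ * _]mulrC.
  - by apply: measurable_funM => //; apply: measurable_funM; [exact: m2|exact: (m1 _ mDt)].
  - by move=> t x tT; rewrite vs// mul0r.
  - apply: filterS uv => t uvt tT; apply: filterS (uvt tT) => x ->.
    by rewrite derive_tensor_fst//= [psi x * _]mulrC.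
have -> : \int[mu]_(t in `[0, T]) \int[mu]_x (h_inv h t x (u t x) ^+ 2 * u t x *
      'D_((0 : R), (1 : R)) ('D_((0 : R), (1 : R)) (tensor theta psi)) (t, x)) =
    \int[mu]_t (\int[mu]_x (flux v (t, x) * 'D_1 ('D_1 psi) x) * theta t).
  rewrite (@Rintegral_strip_ae _ T (fun t x => h_inv h t x (u t x) ^+ 2 * u t x *
      'D_((0 : R), (1 : R)) ('D_((0 : R), (1 : R)) (tensor theta psi)) (t, x))
    (fun z => flux v z * ('D_1 ('D_1 psi) z.2 * theta z.1))).
  - apply: eq_Rintegral => t _.
    rewrite -RintegralZr//.
      by apply: eq_Rintegral => x _; rewrite mulrA.
    exact: (imul _ _ _ t iDDp mfl flC).
  - rewrite (_ : on_strip T _ =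
      (fun z => flux (on_strip T u) z * ('D_1 ('D_1 psi) z.2 * theta z.1))).
      apply: measurable_funM; first exact: measurable_flux.
      by apply: measurable_funM; [exact: (m2 _ mDDp)|exact: m1].
    apply/funext => z; rewrite /flux /on_strip; case: ifP => _; last by rewrite mulr0 mul0r.
    by rewrite derive_tensor_snd2//= [_ * theta _]mulrC.
  - apply: measurable_funM => //.
    by apply: measurable_funM; [exact: (m2 _ mDDp)|exact: m1].
  - by move=> t x tT; rewrite /flux/= vs// mulr0 mul0r.
  - apply: filterS uv => t uvt tT; apply: filterS (uvt tT) => x ->.
    by rewrite derive_tensor_snd2//= /flux/= tT [theta t * _]mulrC.
have -> : \int[mu]_x (u0 x * tensor theta psi (0, x)) =
    \int[mu]_x (u0 x * (theta 0 * psi x)) by [].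
have -> : \int[mu]_t (2^-1 * \int[mu]_x (flux v (t, x) * 'D_1 ('D_1 psi) x) * theta t) =
   2^-1 * \int[mu]_t (\int[mu]_x (flux v (t, x) * 'D_1 ('D_1 psi) x) * theta t).
  rewrite -RintegralZl//; first by apply: eq_Rintegral => t _; rewrite mulrA.
  have [Ct Ct0 thetaC] := continuous_supp_in_bounded _ _ _ (smooth_continuous _ st) ts.
  have [Cp Cp0 DDpC] := continuous_supp_in_bounded _ _ _ (smooth_continuous _ sDDp)
    (supp_in_derive _ _ _ (supp_in_derive _ _ _ ps)).
  apply: (integrable_tested _ _ _ Cp Ct (flux_integrable _ _ mv v0M iv)) => // t.
  exact: (imul _ _ _ t iDDp mfl flC).
by lra.
Qed.

End weak_form.
End flux.

(** * Uniqueness of weak solutions *)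

Section tested_difference.
Context {R : realType}.
Local Notation mu := (@lebesgue_measure R).
Local Notation plane := (@plane R).

(** The two terms of the tested equation are the instances a = 1 and a = 1/2. *)
Lemma tested_difference (F1 F2 : R * R -> R) (f g : R -> R) (C1 C2 Cf Cg a : R) :
  plane.-integrable [set: R * R] (EFin \o F1) ->
  plane.-integrable [set: R * R] (EFin \o F2) ->
  (forall z, `|F1 z| <= C1) -> (forall z, `|F2 z| <= C2) ->
  mu.-integrable [set: R] (EFin \o f) ->
  measurable_fun setT f -> (forall x, `|f x| <= Cf) ->
  measurable_fun setT g -> (forall x, `|g x| <= Cg) ->
  \int[mu]_t (a * \int[mu]_x ((F1 (t, x) - F2 (t, x)) * f x) * g t) =
  \int[mu]_t (a * \int[mu]_x (F1 (t, x) * f x) * g t) -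
  \int[mu]_t (a * \int[mu]_x (F2 (t, x) * f x) * g t).
Proof.
move=> i1 i2 b1 b2 jf mf fC mg gC.
have isec (F : R * R -> R) C t : plane.-integrable [set: R * R] (EFin \o F) ->
    (forall z, `|F z| <= C) ->
    mu.-integrable setT (EFin \o (fun x => F (t, x) * f x)).
  move=> iF FC; have mF : measurable_fun setT (fun x => F (t, x)).
    have : measurable_fun [set: R * R] F.
      by apply/measurable_EFinP; exact: measurable_int iF.
    by move=> mF; apply: (measurableT_comp mF); exact: measurable_fun_pair.
  have := integrable_mul_bounded _ _ _ _ jf mF (fun x => FC (t, x)).
  by apply: eq_integrable => // x _ /=; rewrite mulrC.
have it (F : R * R -> R) C : plane.-integrable [set: R * R] (EFin \o F) ->
    (forall z, `|F z| <= C) ->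
    mu.-integrable setT (EFin \o (fun t => a * \int[mu]_x (F (t, x) * f x) * g t)).
  move=> iF FC; have := integrable_scale a
    (integrable_tested _ _ _ _ _ iF (fun t => isec F C t iF FC) mf fC mg gC).
  by apply: eq_integrable => // t _ /=; rewrite mulrA.
rewrite -RintegralB//; [|exact: it b1|exact: it b2].
apply: eq_Rintegral => t _; rewrite -mulrBl -mulrBr; congr (_ * _ * _).
rewrite -RintegralB//; [|exact: isec b1|exact: isec b2].
by apply: eq_Rintegral => x _; rewrite mulrBl.
Qed.

End tested_difference.

Theorem proposition4p5 (R : realType) (T : R) (h : R -> R -> R -> R)
    (ch c0 C0 Minf : R) (u0 : R -> R)
    (T_gt0 : 0 < T)
    (u0_class : H1_Linfty u0)
    (u0_density : probability_density u0)
    (h_cond : h_conditions T h ch c0 C0)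
    (Minf_bound : ('N[@lebesgue_measure R]_+oo [EFin \o u0] <= Minf%:E)%E)
    (stability : c0 ^+ 2 > 2 * C0 * Minf / ch)
    (u v : R -> R -> R)
    (u_class : solution_class T u)
    (v_class : solution_class T v)
    (u_density : {ae (@lebesgue_measure R), forall t, 0 <= t <= T ->
                    probability_density (u t)})
    (v_density : {ae (@lebesgue_measure R), forall t, 0 <= t <= T ->
                    probability_density (v t)})
    (u_solution : weak_solution T h u0 u)
    (v_solution : weak_solution T h u0 v) :
  {ae (@lebesgue_measure R), forall t, 0 <= t <= T ->
    {ae (@lebesgue_measure R), forall x, u t x = v t x}}.
Proof.
have [u1 [M1 [mu1 u1M u1s iu1 u_u1]]] := clipped_representative _ _ T_gt0 u_class u_density.
have [v1 [M2 [mv1 v1M v1s iv1 v_v1]]] := clipped_representative _ _ T_gt0 v_class v_density.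
pose w z := u1 z - v1 z.
pose g z := flux T h u1 z - flux T h v1 z.
have ifu := flux_integrable _ _ _ _ _ h_cond T_gt0 _ _ mu1 u1M iu1.
have ifv := flux_integrable _ _ _ _ _ h_cond T_gt0 _ _ mv1 v1M iv1.
have u1b z : `|u1 z| <= M1 by have /andP[? ?] := u1M z; rewrite ger0_norm.
have v1b z : `|v1 z| <= M2 by have /andP[? ?] := v1M z; rewrite ger0_norm.
have [Ku fub] : exists K, forall z, `|flux T h u1 z| <= K.
  exists ((C0 + M1 / ch) ^+ 2 * M1) => z.
  rewrite (le_trans (flux_le _ _ _ _ _ h_cond _ _ _ (u1M z)))//.
  by apply: ler_wpM2l; [exact: sqr_ge0|have /andP[] := u1M z].
have [Kv fvb] : exists K, forall z, `|flux T h v1 z| <= K.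
  exists ((C0 + M2 / ch) ^+ 2 * M2) => z.
  rewrite (le_trans (flux_le _ _ _ _ _ h_cond _ _ _ (v1M z)))//.
  by apply: ler_wpM2l; [exact: sqr_ge0|have /andP[] := v1M z].
have mw : measurable_fun [set: R * R] w by exact: measurable_funB.
have mg : measurable_fun [set: R * R] g.
  by apply: measurable_funB; exact: (measurable_flux _ _ _ _ _ h_cond).
pose M := (M1 + M2) + (Ku + Kv).
have wb z : `|w z| <= M1 + M2 by rewrite (le_trans (ler_normB _ _))// lerD.
have gb z : `|g z| <= Ku + Kv by rewrite (le_trans (ler_normB _ _))// lerD.
have wM z : `|w z| <= M.
  by rewrite (le_trans (wb z))// lerDl (le_trans _ (gb z)).
have gM z : `|g z| <= M.
  by rewrite (le_trans (gb z))// lerDr (le_trans _ (wb z)).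
have ig : (@plane R).-integrable [set: R * R] (EFin \o g).
  by have := integrableB measurableT ifu ifv; apply: eq_integrable.
have ws t x : ~~ (0 <= t <= T) -> w (t, x) = 0.
  by move=> tT; rewrite /w u1s// v1s// subrr.
have gs t x : ~~ (0 <= t <= T) -> g (t, x) = 0.
  by move=> tT; rewrite /g /flux u1s// v1s// !mulr0 subrr.
have monotone z : c0 ^+ 2 * w z ^+ 2 <= g z * w z.
  have [zT|zT] := boolP (0 <= z.1 <= T).
    apply: (flux_monotone _ _ _ _ _ h_cond) => //.
      by have /andP[] := u1M z.
    by have /andP[] := v1M z.
  by case: z zT => t x /= tT; rewrite ws// expr0n/= !mulr0.
have weak (theta psi : R -> R) (a b c d : R) : smooth theta -> supp_in a b theta ->
    b < T -> smooth psi -> supp_in c d psi ->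
    \int[lebesgue_measure]_t (\int[lebesgue_measure]_x (w (t, x) * psi x) * 'D_1 theta t) +
    \int[lebesgue_measure]_t (2^-1 * \int[lebesgue_measure]_x (g (t, x) * 'D_1 ('D_1 psi) x) * theta t) = 0.
  move=> st ts bT sp ps.
  have Eu := weak_solution_tensor _ _ _ _ _ h_cond T_gt0 _ _ _ _ u_class u_solution
    iu1 mu1 u1M u1s u_u1 _ _ _ _ _ _ st ts bT sp ps.
  have Ev := weak_solution_tensor _ _ _ _ _ h_cond T_gt0 _ _ _ _ v_class v_solution
    iv1 mv1 v1M v1s v_v1 _ _ _ _ _ _ st ts bT sp ps.
  have sDt : smooth ('D_1 theta : R -> R) by exact: smooth_derive.
  have sDDp : smooth ('D_1 ('D_1 psi) : R -> R) by do 2 apply: smooth_derive.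
  have DDps := supp_in_derive _ _ _ (supp_in_derive _ _ _ ps).
  have [A1 _ b1] := continuous_supp_in_bounded _ _ _ (smooth_continuous _ st) ts.
  have [A2 _ b2] := continuous_supp_in_bounded _ _ _ (smooth_continuous _ sDt) (supp_in_derive _ _ _ ts).
  have [A3 _ b3] := continuous_supp_in_bounded _ _ _ (smooth_continuous _ sp) ps.
  have [A4 _ b4] := continuous_supp_in_bounded _ _ _ (smooth_continuous _ sDDp) DDps.
  have := tested_difference _ _ _ _ _ _ _ _ 1 iu1 iv1 u1b v1b
    (integrable_supp_in _ _ _ (smooth_continuous _ sp) ps)
    (measurable_fun_smooth _ sp) b3 (measurable_fun_smooth _ sDt) b2.
  have := tested_difference _ _ _ _ _ _ _ _ 2^-1 ifu ifv fub fvb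
    (integrable_supp_in _ _ _ (smooth_continuous _ sDDp) DDps)
    (measurable_fun_smooth _ sDDp) b4 (measurable_fun_smooth _ st) b1.
  have mul1E (F : R * R -> R) : \int[lebesgue_measure]_t
     (1 * \int[lebesgue_measure]_x (F (t, x) * psi x) * 'D_1 theta t) =
     \int[lebesgue_measure]_t (\int[lebesgue_measure]_x (F (t, x) * psi x) * 'D_1 theta t).
    by apply: eq_Rintegral => t _; rewrite mul1r.
  rewrite (mul1E (fun z => u1 z - v1 z)) (mul1E u1) (mul1E v1) => -> ->.
  by rewrite addrACA -opprD Eu Ev subrr.
have c2 : 0 < c0 ^+ 2 by rewrite exprn_gt0// (h_c0_gt0 h_cond).
have w0 := monotone_flux_unique _ _ _ _ _ mw mg wM gM ig ws gs weak c2 monotone.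
have FF := ae_filter_ringOfSetsType (@lebesgue_measure R).
apply: filterS3 w0 u_u1 v_v1 => t w0t uu vv tT.
apply: filterS3 w0t (uu tT) (vv tT) => x /eqP w0x -> ->.
by move: w0x; rewrite /w subr_eq0 => /eqP.
Qed.
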